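(* Let $C=75$ and $\alpha=0.01$. Let $K\ge 2$ be an integer, let $0<\delta<1$, and let $\Phi=[\varphi_1\cdots\varphi_N]$ be a random $M\times N$ matrix whose entries are drawn independently from a Gaussian distribution with mean zero and variance $\frac{1}{M}$. If $$M\geq\frac{33C^2}{\delta^2}\,K\log^2 K\,\log N,$$ then with high probability $\Phi$ has $\big(K,\frac{(1-\alpha)\delta}{2C\log K}\big)$-flat restricted orthogonality and $\delta_1\leq\alpha\delta$, and therefore $\Phi$ has the $(2K,\delta)$-restricted isometry property. Here ''with high probability'' means: for every $\varepsilon>0$ there is $N_0$ such that for all $N\ge N_0$ and all $M$, $\delta\in(0,1)$ and $2\le K\le N$ satisfying the displayed inequality, the probability that all of these properties hold is at least $1-\varepsilon$.
   Context: $\log$ is the natural logarithm and $\|\cdot\|$ is the Euclidean norm. A vector is $K$-sparse if at most $K$ of its entries are nonzero. A matrix $\Phi$ has the $(K,\delta)$-restricted isometry property (RIP) if $(1-\delta)\|x\|^2\leq\|\Phi x\|^2\leq(1+\delta)\|x\|^2$ for every $K$-sparse vector $x$; the smallest $\delta$ for which $\Phi$ is $(K,\delta)$-RIP is the restricted isometry constant $\delta_K$ of $\Phi$. In particular $\delta_1=\max_{n}\big|\|\varphi_n\|^2-1\big|$. A matrix $\Phi=[\varphi_1\cdots\varphi_N]$ with columns $\varphi_n$ has $(K,\hat\theta)$-flat restricted orthogonality if $$\bigg|\bigg\langle \sum_{i\in\mathcal{I}}\varphi_i,\sum_{j\in\mathcal{J}}\varphi_j\bigg\rangle\bigg|\leq\hat\theta(|\mathcal{I}||\mathcal{J}|)^{1/2}$$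 for every disjoint pair of subsets $\mathcal{I},\mathcal{J}\subseteq\{1,\ldots,N\}$ with $|\mathcal{I}|,|\mathcal{J}|\leq K$. *)

(* Defs.v *)
From HB Require Import structures.
From mathcomp Require Import all_boot all_order all_algebra.
From mathcomp Require Import all_classical all_reals all_analysis.

Set Implicit Arguments.
Unset Strict Implicit.
Unset Printing Implicit Defensive.

Import Order.TTheory GRing.Theory Num.Theory.
Import numFieldNormedType.Exports.

Local Open Scope classical_set_scope.
Local Open Scope ring_scope.

Section RestrictedIsometry.
Context {R : realType}.

Definition dotcv (n : nat) (u v : 'cV[R]_n) : R := \sum_(i < n) u i 0 * v i 0.

(* The norm that the library puts on matrices is the sup norm. *)
Definition normcv (n : nat) (u : 'cV[R]_n) : R := Num.sqrt (dotcv u u).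

Definition sparse (n K : nat) (x : 'cV[R]_n) : Prop :=
  (#|[pred i : 'I_n | x i 0%R != 0%R]| <= K)%N.

Definition has_RIP (M N : nat) (Phi : 'M[R]_(M, N)) (K : nat) (delta : R) :
    Prop :=
  forall x : 'cV[R]_N, sparse K x ->
    (1 - delta) * normcv x ^+ 2 <= normcv (Phi *m x) ^+ 2 /\
    normcv (Phi *m x) ^+ 2 <= (1 + delta) * normcv x ^+ 2.

(* For 0 < K and 0 < N the set is nonempty, bounded below by 0 and closed, so
   that its infimum is its least element. *)
Definition ric (M N : nat) (Phi : 'M[R]_(M, N)) (K : nat) : R :=
  inf [set delta : R | has_RIP Phi K delta].

Definition has_flat_RO (M N : nat) (Phi : 'M[R]_(M, N)) (K : nat) (theta : R) :
    Prop :=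
  forall I J : {set 'I_N}, [disjoint I & J]%B -> (#|I| <= K)%N -> (#|J| <= K)%N ->
    `|dotcv (\sum_(i in I) col i Phi) (\sum_(j in J) col j Phi)|
      <= theta * Num.sqrt (#|I|%:R * #|J|%:R).

End RestrictedIsometry.

Section RandomMatrix.
Context {R : realType} {d : measure_display} {T : measurableType d}.
Variable P : probability T R.

Definition mutually_independent (I : finType) (X : I -> {RV P >-> R}) : Prop :=
  forall (J : {set I}) (A : I -> set R),
    (forall i, i \in J -> measurable (A i)) ->
    P [set w | forall i, i \in J -> A i (X i w)] =
      (\prod_(i in J) P [set w | A i (X i w)])%E.

(* The second parameter of [normal_prob] is the standard deviation.  Equality
   of laws is required on measurable sets only: the library applies measures to
   arbitrary sets, but their values elsewhere carry no meaning. *)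
Definition has_normal_law (X : {RV P >-> R}) (mean variance : R) : Prop :=
  forall A : set R, measurable A ->
    distribution P X A = normal_prob mean (Num.sqrt variance) A.

Definition iid_normal (M N : nat) (Phi : 'I_M -> 'I_N -> {RV P >-> R})
    (mean variance : R) : Prop :=
  mutually_independent (fun ij : 'I_M * 'I_N => Phi ij.1 ij.2) /\
  forall i j, has_normal_law (Phi i j) mean variance.

Definition realization (M N : nat) (Phi : 'I_M -> 'I_N -> {RV P >-> R})
    (w : T) : 'M[R]_(M, N) := \matrix_(i, j) Phi i j w.

End RandomMatrix.

(* Main.v *)
Require Import Defs.
From HB Require Import structures.
From mathcomp Require Import all_boot all_order all_algebra.
From mathcomp Require Import all_classical all_reals all_analysis.
From mathcomp Require Import measurable_realfun.
From mathcomp Require Import ring lra zify.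

Set Implicit Arguments.
Unset Strict Implicit.
Unset Printing Implicit Defensive.

Import Order.TTheory GRing.Theory Num.Theory.
Import numFieldNormedType.Exports.

Local Open Scope classical_set_scope.
Local Open Scope ring_scope.

(** From flat restricted orthogonality to RIP: if a linear form [l] satisfies
    [|l(1_A)| <= c sqrt |A|] for all sets [A], sorting the coordinates of a
    nonnegative [x] and summing by parts gives
    [l(x) <= c \sum_k x_k (sqrt (k+1) - sqrt k)], and Cauchy-Schwarz bounds this
    by [c sqrt (1 + ln n) |x|].  Applied in each argument of the Gram form, this
    yields a bilinear bound on disjoint supports, and averaging over all ways to
    split the index set in two controls the off-diagonal part of [|Phi x|^2].
    The constants are far better than [C = 75], so sets of size up to [2K] are
    simply cut in two.

    Flat restricted orthogonality of a Gaussian matrix: for disjoint [I] and [J]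
    the inner product is a sum over the rows of products [U V] of independent
    centered normal variables with variances [|I|/M] and [|J|/M], so
    [E exp(lam U V) = (1 - lam^2 |I||J|/M^2)^(-1/2)], and Markov's inequality
    gives the tail [2 exp(-M theta^2/3)].  This beats the [N^(2K)] pairs of sets;
    the norms of the columns are treated in the same way. *)

(** * Flat restricted orthogonality implies RIP *)

Section AbelSummation.
Context {R : realType}.

Lemma sum_sqr_ge0 (I : Type) (r : seq I) (Q : pred I) (F : I -> R) :
  0 <= \sum_(i <- r | Q i) F i ^+ 2.
Proof. by apply: sumr_ge0 => i _; exact: sqr_ge0. Qed.

(** Cauchy-Schwarz. The quadratic [A t^2 - 2 D t + B] is a sum of squares, hence nonnegative; its
    value at the minimizer [t = D / A] gives the claim. *)
Lemma sum_mul_sqr_le (I : Type) (r : seq I) (Q : pred I) (a b : I -> R) :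
  (\sum_(i <- r | Q i) a i * b i) ^+ 2 <=
  (\sum_(i <- r | Q i) a i ^+ 2) * (\sum_(i <- r | Q i) b i ^+ 2).
Proof.
set A := \sum_(i <- r | Q i) a i ^+ 2; set B := \sum_(i <- r | Q i) b i ^+ 2.
set D := \sum_(i <- r | Q i) a i * b i.
have quad (t : R) : 0 <= A * t ^+ 2 - 2 * D * t + B.
  have -> : A * t ^+ 2 - 2 * D * t + B =
      \sum_(i <- r | Q i) (a i * t - b i) ^+ 2.
    rewrite /A /B /D mulr_suml mulr_sumr mulr_suml -sumrB -big_split /=.
    by apply: eq_bigr => i _; ring.
  exact: sum_sqr_ge0.
have A0 : 0 <= A by exact: sum_sqr_ge0.
have [Ae|An] := eqVneq A 0; last first.
  have Ap : 0 < A by rewrite lt_def An.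
  have := quad (D / A).
  have -> : A * (D / A) ^+ 2 - 2 * D * (D / A) + B = B - D ^+ 2 / A by field.
  by rewrite subr_ge0 ler_pdivrMr // mulrC.
rewrite Ae mul0r.
have [->|Dn] := eqVneq D 0; first by rewrite expr0n.
(* With [A = 0] the quadratic is affine in [t]; at this [t] it equals [-1], so [D] must vanish. *)
have := quad ((B + 1) / (2 * D)).
rewrite Ae mul0r.
have -> : 0 - 2 * D * ((B + 1) / (2 * D)) + B = -1 by field.
by rewrite lerNr oppr0 ler10.
Qed.

Lemma sum_mul_le_sqrt (I : Type) (r : seq I) (Q : pred I) (a b : I -> R) :
  `|\sum_(i <- r | Q i) a i * b i| <=
  Num.sqrt (\sum_(i <- r | Q i) a i ^+ 2) *
  Num.sqrt (\sum_(i <- r | Q i) b i ^+ 2).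
Proof.
rewrite -sqrtrM ?sum_sqr_ge0 // -sqrtr_sqr ler_sqrt.
  exact: sum_mul_sqr_le.
by rewrite mulr_ge0 // sum_sqr_ge0.
Qed.

(** Induction: monotonicity replaces [a n.+1 * D n.+1] by [a n * D n.+1], which splits into the
    previous value and the new term. Below, [D] is the slack in a bound on partial sums. *)
Lemma abel_sum_ge (n : nat) (a D : nat -> R) :
  (forall k, 0 <= D k) -> D 0 = 0 -> (forall k, a k.+1 <= a k) ->
  a n * D n <= \sum_(k < n) a k * (D k.+1 - D k).
Proof.
move=> D0 De a_ni; elim: n => [|n IHn]; first by rewrite big_ord0 De mulr0.
rewrite big_ord_recr /=.
apply: (@le_trans _ _ (a n * D n.+1)); first exact: ler_wpM2r.
have -> : a n * D n.+1 = a n * D n + a n * (D n.+1 - D n) by ring.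
exact: lerD.
Qed.

(** The difference is [- ln (1 - 1/(n+2))], and [ln (1 + x) <= x]. *)
Lemma ln_succ_sub_ge (n : nat) :
  n.+2%:R^-1 <= ln (n.+2%:R : R) - ln (n.+1%:R : R).
Proof.
rewrite -ln_div ?posrE ?ltr0n //.
have e : (n.+2%:R / n.+1%:R : R)^-1 = 1 + - n.+2%:R^-1.
  have n0 : (n.+2%:R : R) != 0 by rewrite pnatr_eq0.
  rewrite invf_div; apply: (mulIf n0).
  rewrite mulrVK ?unitfE // mulrDl mulNr mulVf // mul1r -[n.+2]addn1.
  by rewrite natrD addrK.
rewrite -[X in _ <= X]opprK -lnV ?posrE ?divr_gt0 ?ltr0n // e lerNr.
apply: le_ln1Dx; rewrite ltrN2 invf_lt1 ?ltr0n //.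
by rewrite ltr1n.
Qed.

(** With [u] and [v] the two roots, [u - v = 1 / (u + v) <= 1 / u]. *)
Lemma sqr_sub_sqrt_succ (k : nat) :
  (Num.sqrt k.+1%:R - Num.sqrt k%:R) ^+ 2 <= (k.+1%:R : R)^-1.
Proof.
set u := Num.sqrt k.+1%:R; set v := Num.sqrt k%:R.
have uu : u ^+ 2 = k.+1%:R by rewrite sqr_sqrtr.
have vv : v ^+ 2 = k%:R by rewrite sqr_sqrtr.
have v0 : 0 <= v by exact: sqrtr_ge0.
have u0 : 0 < u by rewrite sqrtr_gt0 ltr0n.
have duv : (u - v) * (u + v) = 1 by rewrite -subr_sqr uu vv -natrB // subSnn.
rewrite -uu -exprVn ler_pXn2r ?nnegrE ?invr_ge0 ?(ltW u0) //; last first.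
  by rewrite subr_ge0 /u /v ler_sqrt ?ler_nat // ler0n.
rewrite -[X in _ <= X]mul1r ler_pdivlMr // -duv ler_wpM2l //.
  by rewrite subr_ge0 /u /v ler_sqrt ?ler_nat // ler0n.
by rewrite lerDl.
Qed.

(** A harmonic sum: the first term is [1], and each later one is at most an increment of [ln]. *)
Lemma sum_sqr_sub_sqrt (n : nat) :
  \sum_(k < n.+1) (Num.sqrt k.+1%:R - Num.sqrt k%:R) ^+ 2
    <= 1 + ln (n.+1%:R : R).
Proof.
elim: n => [|n IHn].
  by rewrite big_ord_recr big_ord0 /= ln1 add0r addr0 sqrtr1 sqrtr0 subr0 expr1n.
rewrite big_ord_recr /=.
apply: le_trans (lerD IHn (le_trans (sqr_sub_sqrt_succ n.+1) (ln_succ_sub_ge n))) _.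
by rewrite addrACA subrr addr0 ?addrA // addrC subrK.
Qed.

(** Applying [abel_sum_ge] to the slack [D k = c sqrt k - L k] puts [c sqrt k] in the place of
    [L k]; Cauchy-Schwarz then separates [a] from the increments. *)
Lemma abel_sum_le (n : nat) (a L : nat -> R) (c : R) :
  (forall k, 0 <= a k) -> (forall k, a k.+1 <= a k) -> L 0 = 0 ->
  (forall k, L k <= c * Num.sqrt k%:R) -> 0 <= c ->
  \sum_(k < n) a k * (L k.+1 - L k) <=
  c * (Num.sqrt (1 + ln (n.+1%:R : R)) * Num.sqrt (\sum_(k < n) a k ^+ 2)).
Proof.
move=> a0 a_ni L0 Lc c0.
pose D k := c * Num.sqrt k%:R - L k.
have D0 k : 0 <= D k by rewrite subr_ge0.
have De : D 0 = 0 by rewrite /D L0 sqrtr0 mulr0 subr0.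
have := abel_sum_ge n D0 De a_ni.
move/(le_trans (mulr_ge0 (a0 n) (D0 n))) => H.
have {}H : \sum_(k < n) a k * (L k.+1 - L k) <=
    c * \sum_(k < n) a k * (Num.sqrt k.+1%:R - Num.sqrt k%:R).
  rewrite -subr_ge0 mulr_sumr -sumrB; apply: le_trans H _.
  by rewrite le_eqVlt; apply/orP; left; apply/eqP; apply: eq_bigr => k _;
     rewrite /D; ring.
apply: le_trans H _; rewrite ler_wpM2l //.
apply: le_trans (ler_norm _) _; apply: le_trans (sum_mul_le_sqrt _ _ _ _) _.
rewrite mulrC ler_wpM2r ?sqrtr_ge0 // ler_sqrt; last first.
  by rewrite addr_ge0 // ln_ge0 // ler1n.
(* One more nonnegative term is added so that [n = 0] is covered; hence [n.+1] under the
   logarithm. *)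
apply: le_trans (sum_sqr_sub_sqrt n).
by rewrite big_ord_recr /= lerDl sqr_ge0.
Qed.

End AbelSummation.

(** * Linear forms that are small on indicator vectors *)

Section FlatLinear.
Context {R : realType}.
Implicit Types (I : finType) (c : R).

(** When [S] is listed by decreasing [x], the prefix sums [L k] of [l] run over sets of at most [k]
    elements, so the hypothesis bounds them by [c sqrt k] and [abel_sum_le] applies. *)
Lemma flat_linear_ge0 I (S : {set I}) (l x : I -> R) c :
  0 <= c -> (forall i, i \in S -> 0 <= x i) ->
  (forall A : {set I}, A \subset S ->
    \sum_(i in A) l i <= c * Num.sqrt #|A|%:R) ->
  \sum_(i in S) x i * l i <=
  c * (Num.sqrt (1 + ln (#|S|.+1%:R : R)) *
       Num.sqrt (\sum_(i in S) x i ^+ 2)).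
Proof.
move=> c0 x0 lc.
pose s := sort (fun i j => x j <= x i) (enum S).
have sS i : (i \in s) = (i \in S) by rewrite mem_sort mem_enum.
have us : uniq s by rewrite sort_uniq enum_uniq.
have ss : size s = #|S| by rewrite size_sort -cardE.
have sumS (F : I -> R) : \sum_(i in S) F i = \sum_(i <- s) F i.
  by rewrite -big_enum; apply: perm_big; rewrite perm_sym perm_sort.
(* The default [0] keeps [a] nonnegative and nonincreasing past the end of the list. *)
pose a k := nth 0 (map x s) k.
pose L k := \sum_(i <- take k s) l i.
have srt : sorted (fun u v : R => v <= u) (map x s).
  by rewrite sorted_map; apply: sort_sorted => i j; exact: le_total.
have a0 k : 0 <= a k.
  rewrite /a; have [ks|ks] := ltnP k (size (map x s)); last by rewrite nth_default.
  have /mapP[i] := mem_nth 0 ks; rewrite sS => iS ->; exact: x0.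
have a_ni k : a k.+1 <= a k.
  have [ks|ks] := ltnP k.+1 (size (map x s)); first by move/sortedP: srt; apply.
  by rewrite {1}/a nth_default.
have L0 : L 0 = 0 by rewrite /L take0 big_nil.
have Lc k : L k <= c * Num.sqrt k%:R.
  have -> : L k = \sum_(i in [set i in take k s]) l i.
    rewrite /L -big_enum; apply: perm_big.
    apply: uniq_perm; rewrite ?enum_uniq ?take_uniq // => i.
    by rewrite mem_enum inE.
  apply: (le_trans (lc _ _)).
    by apply/fintype.subsetP => i; rewrite inE -sS; exact: mem_take.
  rewrite ler_wpM2l // ler_sqrt ?ler0n // ler_nat cardsE.
  by apply: leq_trans (card_size _) _; rewrite size_take_min geq_minl.
have := abel_sum_le (size s) a0 a_ni L0 Lc c0.
(* The nonempty case supplies [i0] as the default of [nth] in [I]. *)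
case: s => [|i0 s'] in sS us ss sumS a L srt a0 a_ni L0 Lc *.
  by rewrite sumS big_nil => _; rewrite !mulr_ge0 // sqrtr_ge0.
set s := i0 :: s' in sS us ss sumS a L srt a0 a_ni L0 Lc *.
rewrite ss.
suff [-> ->] : \sum_(k < #|S|) a k * (L k.+1 - L k) = \sum_(i in S) x i * l i /\
   \sum_(k < #|S|) a k ^+ 2 = \sum_(i in S) x i ^+ 2 by [].
split; rewrite sumS (big_nth i0) big_mkord -ss; apply: eq_bigr => k _.
  rewrite /a (nth_map i0) // /L (take_nth i0) // -cats1 big_cat /= big_seq1.
  by rewrite addrAC subrr add0r.
by rewrite /a (nth_map i0).
Qed.

(** The sign of [x] splits [S] in two, and each half costs one use of [flat_linear_ge0], whence the
    factor [2]. The lower bound is the upper bound for [- l]. *)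
Lemma flat_linear I (S : {set I}) (l x : I -> R) c :
  0 <= c ->
  (forall A : {set I}, A \subset S ->
    `|\sum_(i in A) l i| <= c * Num.sqrt #|A|%:R) ->
  `|\sum_(i in S) x i * l i| <=
  c * (2 * Num.sqrt (1 + ln (#|S|.+1%:R : R)) *
       Num.sqrt (\sum_(i in S) x i ^+ 2)).
Proof.
move=> c0; set h := Num.sqrt (1 + _); set q := Num.sqrt (\sum_(i in S) _).
have part (T : {set I}) (y m : I -> R) : T \subset S ->
    (forall i, i \in T -> 0 <= y i) -> (forall i, y i ^+ 2 = x i ^+ 2) ->
    (forall A : {set I}, A \subset S ->
      `|\sum_(i in A) m i| <= c * Num.sqrt #|A|%:R) ->
    \sum_(i in T) y i * m i <= c * (h * q).
  move=> TS y0 yx mc.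
  apply: (le_trans (flat_linear_ge0 c0 y0 _)) => [A AT|].
    by apply: le_trans (ler_norm _) (mc _ _); exact: fintype.subset_trans TS.
  rewrite ler_wpM2l // ler_pM ?sqrtr_ge0 // /h /q.
    rewrite ler_sqrt ?addr_ge0 ?ln_ge0 ?ler1n // lerD2l ler_ln ?posrE ?ltr0n //.
    by rewrite ler_nat ltnS subset_leq_card.
  rewrite ler_sqrt ?sum_sqr_ge0 // (eq_bigr _ (fun i _ => yx i)).
  by rewrite [X in _ <= X](big_setID T) /= (finset.setIidPr TS) lerDl sum_sqr_ge0.
have main (m : I -> R) : (forall A : {set I}, A \subset S ->
      `|\sum_(i in A) m i| <= c * Num.sqrt #|A|%:R) ->
    \sum_(i in S) x i * m i <= c * (2 * h * q).
  move=> mc; pose T := [set i in S | 0 <= x i].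
  have TS : T \subset S by apply/fintype.subsetP => i; rewrite inE => /andP[].
  rewrite (big_setID T) /= (finset.setIidPr TS).
  have -> : c * (2 * h * q) = c * (h * q) + c * (h * q) by ring.
  apply: lerD; first by apply: part => // i; rewrite inE => /andP[].
  (* Where [x] is negative, the pair [- x], [- l] has the same products and satisfies the hypotheses
     of [part]. *)
  under eq_bigr do rewrite -mulrNN.
  apply: (part _ (fun i => - x i) (fun i => - m i)).
  - exact: finset.subsetDl.
  - move=> i; rewrite !inE => /andP[+ iS].
    by rewrite iS /= -ltNge oppr_ge0 => /ltW.
  - by move=> i; rewrite sqrrN.
  - by move=> A AS; rewrite sumrN normrN mc.
move=> lc; rewrite ler_norml main // andbT lerNl -sumrN.
under eq_bigr do rewrite -mulrN.
by apply: main => A AS; rewrite sumrN normrN lc.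
Qed.

End FlatLinear.

(** * Bilinear bounds on supports of size [2K], and decoupling *)

Section Decoupling.
Context {R : realType}.

(** The first [K] elements of [S] and the remaining ones both form admissible sets, each
    contributing at most [c sqrt |S|]. *)
Lemma flat_double (I : finType) (K : nat) (S : {set I}) (l : I -> R) c :
  0 <= c -> (#|S| <= 2 * K)%N ->
  (forall A : {set I}, A \subset S -> (#|A| <= K)%N ->
    `|\sum_(i in A) l i| <= c * Num.sqrt #|A|%:R) ->
  `|\sum_(i in S) l i| <= 2 * c * Num.sqrt #|S|%:R.
Proof.
move=> c0 SK lc.
pose A := [set i in take K (enum S)].
have AS : A \subset S.
  by apply/fintype.subsetP => i; rewrite inE => /mem_take; rewrite mem_enum.
have At : #|A| = minn K #|S|.
  rewrite cardsE (card_uniqP _) ?take_uniq ?enum_uniq //.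
  by rewrite size_take_min -cardE.
have AK : (#|A| <= K)%N by rewrite At geq_minl.
have BK : (#|S :\: A| <= K)%N.
  by rewrite cardsD (finset.setIidPr AS) At; lia.
have part (T : {set I}) : T \subset S -> (#|T| <= K)%N ->
    `|\sum_(i in T) l i| <= c * Num.sqrt #|S|%:R.
  move=> TS TK; apply: le_trans (lc _ TS TK) _.
  by rewrite ler_wpM2l // ler_sqrt ?ler0n // ler_nat subset_leq_card.
rewrite (big_setID A) /= (finset.setIidPr AS).
apply: le_trans (ler_normD _ _) _.
have -> : 2 * c * Num.sqrt #|S|%:R =
  c * Num.sqrt #|S|%:R + c * Num.sqrt #|S|%:R by ring.
by apply: lerD; apply: part => //; exact: finset.subsetDl.
Qed.

(** The [4] is the [2] of cutting sets in two times the [2] of splitting by sign. *)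
Lemma flat_linear_double (I : finType) (K : nat) (S : {set I}) (l x : I -> R) c :
  0 <= c -> (#|S| <= 2 * K)%N ->
  (forall A : {set I}, A \subset S -> (#|A| <= K)%N ->
    `|\sum_(i in A) l i| <= c * Num.sqrt #|A|%:R) ->
  `|\sum_(i in S) x i * l i| <=
  4 * Num.sqrt (1 + ln ((2 * K).+1%:R : R)) * c *
    Num.sqrt (\sum_(i in S) x i ^+ 2).
Proof.
move=> c0 SK lc.
apply: le_trans (flat_linear x (_ : 0 <= 2 * c) _) _.
- by rewrite mulr_ge0.
- move=> A AS; apply: (flat_double (K := K)) => //.
    exact: leq_trans (subset_leq_card AS) SK.
  by move=> B BA; apply: lc; exact: fintype.subset_trans AS.
- set q := Num.sqrt (\sum_(i in S) _).
  rewrite [leLHS](_ : _ = 4 * Num.sqrt (1 + ln (#|S|.+1%:R : R)) * c * q);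
    last by ring.
  rewrite ler_wpM2r ?sqrtr_ge0 // ler_wpM2r // ler_wpM2l //.
  rewrite ler_sqrt ?addr_ge0 ?ln_ge0 ?ler1n // lerD2l ler_ln ?posrE ?ltr0n //.
  by rewrite ler_nat ltnS.
Qed.

(** The linear bound is used once in each argument: [16 = 4 * 4], and the two factors [h] multiply
    to the logarithmic term. *)
Lemma flat_bilinear (I : finType) (K : nat) (S T : {set I}) (g : I -> I -> R)
    (x y : I -> R) c :
  0 <= c -> (#|S| <= 2 * K)%N -> (#|T| <= 2 * K)%N ->
  (forall A B : {set I}, A \subset S -> B \subset T ->
    (#|A| <= K)%N -> (#|B| <= K)%N ->
    `|\sum_(i in A) \sum_(j in B) g i j| <= c * Num.sqrt (#|A|%:R * #|B|%:R)) ->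
  `|\sum_(i in S) \sum_(j in T) x i * y j * g i j| <=
  16 * (1 + ln ((2 * K).+1%:R : R)) * c *
    (Num.sqrt (\sum_(i in S) x i ^+ 2) * Num.sqrt (\sum_(j in T) y j ^+ 2)).
Proof.
move=> c0 SK TK gc.
set q := Num.sqrt (\sum_(j in T) _).
set h := Num.sqrt (1 + ln ((2 * K).+1%:R : R)).
have hh : 1 + ln ((2 * K).+1%:R : R) = h ^+ 2.
  by rewrite sqr_sqrtr // addr_ge0 ?ln_ge0 ?ler1n.
have h0 : 0 <= h by exact: sqrtr_ge0.
have q0 : 0 <= q by exact: sqrtr_ge0.
have -> : \sum_(i in S) \sum_(j in T) x i * y j * g i j =
    \sum_(i in S) x i * (\sum_(j in T) y j * g i j).
  apply: eq_bigr => i _; rewrite mulr_sumr; apply: eq_bigr => j _.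
  by rewrite mulrA.
apply: le_trans (flat_linear_double (K := K) (c := 4 * h * c * q) _ _ SK _) _.
- by rewrite !mulr_ge0.
(* For fixed [A] the form in [y] is flat with constant [c sqrt |A|]; this [sqrt |A|] is what
   flatness of the outer form in [x] requires. *)
- move=> A AS AK; rewrite exchange_big /=.
  under eq_bigr do rewrite -mulr_sumr.
  apply: le_trans
    (flat_linear_double (K := K) (c := c * Num.sqrt #|A|%:R) _ _ TK _) _.
  + by rewrite mulr_ge0 ?sqrtr_ge0.
  + move=> B BT BK; rewrite exchange_big -mulrA -sqrtrM ?ler0n //.
    exact: gc.
  + by rewrite -/h -/q [leLHS](_ : _ = 4 * h * c * q * Num.sqrt #|A|%:R) //; ring.
- by rewrite -/h hh le_eqVlt; apply/orP; left; apply/eqP; ring.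
Qed.

(** Such a set is [i |: B] with [B] avoiding both points, so there are a quarter of [2 ^ #|I|];
    multiplying by [4] avoids a subtraction in the exponent. *)
Lemma card_separating_sets (I : finType) (i j : I) : i != j ->
  (4 * #|[set A : {set I} | (i \in A) && (j \notin A)]%SET| = 2 ^ #|I|)%N.
Proof.
move=> ij.
have -> : [set A : {set I} | (i \in A) && (j \notin A)]%SET =
    [set i |: B | B in powerset (~: [set i; j])]%SET.
  apply/setP => A; rewrite inE; apply/andP/imsetP => [[iA jA]|[B]].
    exists (A :\ i); last by rewrite finset.setD1K.
    rewrite powersetE; apply/fintype.subsetP => k; rewrite !inE => /andP[ki kA].
    by rewrite negb_or ki; apply: contraNneq jA => <-.
  rewrite powersetE => /fintype.subsetP sB ->; rewrite !inE eqxx eq_sym.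
  split=> //; rewrite negb_or ij; apply/negP => /sB.
  by rewrite !inE eqxx orbT.
rewrite card_in_imset => [|B1 B2]; last first.
  rewrite !powersetE => /fintype.subsetP s1 /fintype.subsetP s2 e.
  have n1 : i \notin B1 by apply/negP => /s1; rewrite !inE eqxx.
  have n2 : i \notin B2 by apply/negP => /s2; rewrite !inE eqxx.
  by rewrite -(setU1K n1) e setU1K.
rewrite card_powerset -(cardsC [set i; j]%SET) cards2 ij.
by rewrite expnD.
Qed.

(* Each ordered pair [i != j] is separated by exactly a quarter of all sets. *)
Lemma decoupling (I : finType) (w : I -> I -> R) (b : R) :
  (forall A : {set I}, `|\sum_(i in A) \sum_(j in ~: A) w i j| <= b) ->
  `|\sum_i \sum_(j | j != i) w i j| <= 4 * b.
Proof.
move=> wb.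
have key : (2 ^ #|I|)%:R * (\sum_i \sum_(j | j != i) w i j) =
    4 * \sum_(A : {set I}) \sum_(i in A) \sum_(j in ~: A) w i j.
  have ifE (A : {set I}) : \sum_(i in A) \sum_(j in ~: A) w i j =
      \sum_i \sum_j if (i \in A) && (j \notin A) then w i j else 0.
    rewrite big_mkcond; apply: eq_bigr => i _; case: ifP => iA /=.
      by rewrite big_mkcond; apply: eq_bigr => j _; rewrite inE.
    by rewrite big1.
  rewrite (eq_bigr _ (fun A _ => ifE A)).
  rewrite exchange_big /= !mulr_sumr; apply: eq_bigr => i _.
  rewrite exchange_big /= !mulr_sumr big_mkcond; apply: eq_bigr => j _.
  rewrite -big_mkcond sumr_const /=.
  (* No set separates an index from itself, so the diagonal contributes to neither side. *)
  have [->|ji] := eqVneq j i.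
    rewrite /= (_ : #|_| = 0%N) ?mulr0n ?mulr0 //.
    by apply: eq_card0 => A; rewrite unfold_in /= andbN.
  rewrite -(card_separating_sets (i := i) (j := j)) 1?eq_sym //.
  rewrite natrM -[w i j *+ _]mulr_natl mulrA; congr (_ * _%:R * _).
  by rewrite cardsE.
have p : 0 < (2 ^ #|I|)%:R :> R by rewrite ltr0n expn_gt0.
rewrite -(ler_pM2l p) -[X in X * _](gtr0_norm p) -normrM key normrM.
rewrite ger0_norm // mulrCA ler_pM2l //.
apply: le_trans (ler_norm_sum _ _ _) _; apply: le_trans (ler_sum _ _) _.
  by move=> A _; exact: wb.
rewrite sumr_const (eq_card (B := powerset [set: I]%SET)) => [|A].
  by rewrite card_powerset cardsT mulr_natl.
by rewrite powersetT inE.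
Qed.

End Decoupling.

(** * Restricted isometry in terms of the Gram matrix *)

Section RIP.
Context {R : realType} (M N : nat).
Implicit Types (Phi : 'M[R]_(M, N)) (x : 'cV[R]_N).

Definition gram Phi (i j : 'I_N) : R := dotcv (col i Phi) (col j Phi).

Lemma normcv_sqr n (u : 'cV[R]_n) : normcv u ^+ 2 = \sum_i u i 0 ^+ 2.
Proof.
rewrite /normcv /dotcv; under eq_bigr do rewrite -expr2.
by rewrite sqr_sqrtr ?sum_sqr_ge0.
Qed.

Lemma dotcv_sum_col Phi (I J : {set 'I_N}) :
  dotcv (\sum_(i in I) col i Phi) (\sum_(j in J) col j Phi) =
  \sum_(i in I) \sum_(j in J) gram Phi i j.
Proof.
rewrite /dotcv /gram /dotcv; under eq_bigr do rewrite !summxE big_distrl /=.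
rewrite exchange_big /=; apply: eq_bigr => i _.
under eq_bigr do rewrite big_distrr /=.
by rewrite exchange_big.
Qed.

Lemma normcv_mulmx Phi x : normcv (Phi *m x) ^+ 2 =
  \sum_i \sum_j x i 0 * x j 0 * gram Phi i j.
Proof.
rewrite normcv_sqr; under eq_bigr do rewrite mxE expr2 big_distrl /=.
rewrite exchange_big /=; apply: eq_bigr => i _.
under eq_bigr do rewrite big_distrr /=.
rewrite exchange_big /=; apply: eq_bigr => j _.
by rewrite /gram /dotcv mulr_sumr; apply: eq_bigr => k _; rewrite !mxE; ring.
Qed.

(** Column norms control the first sum; decoupling and flat restricted orthogonality control the
    second. *)
Lemma normcv_mulmx_diag Phi x : normcv (Phi *m x) ^+ 2 - normcv x ^+ 2 =
  \sum_i x i 0 ^+ 2 * (gram Phi i i - 1) +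
  \sum_i \sum_(j | j != i) x i 0 * x j 0 * gram Phi i j.
Proof.
rewrite normcv_mulmx normcv_sqr -big_split -sumrB /=.
by apply: eq_bigr => i _; rewrite (bigD1 i) //=; ring.
Qed.

Lemma has_RIPP Phi K delta : has_RIP Phi K delta <->
  forall x, sparse K x ->
    `|normcv (Phi *m x) ^+ 2 - normcv x ^+ 2| <= delta * normcv x ^+ 2.
Proof.
split=> H x xK; have := H x xK; rewrite ler_norml.
  by move=> [H1 H2]; apply/andP; split; lra.
by move=> /andP[H1 H2]; split; lra.
Qed.

Lemma diag_bound Phi x eta : (forall j, `|gram Phi j j - 1| <= eta) ->
  `|\sum_i x i 0 ^+ 2 * (gram Phi i i - 1)| <= eta * normcv x ^+ 2.
Proof.
move=> He; apply: le_trans (ler_norm_sum _ _ _) _.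
rewrite normcv_sqr mulr_sumr; apply: ler_sum => i _.
by rewrite normrM ger0_norm ?sqr_ge0 // mulrC ler_wpM2r ?sqr_ge0.
Qed.

(** One direction tests the basis vectors; in the other, a 1-sparse vector has no two nonzero
    entries, so the off-diagonal sum vanishes. *)
Lemma has_RIP1P Phi delta : has_RIP Phi 1 delta <->
  forall j, `|gram Phi j j - 1| <= delta.
Proof.
rewrite has_RIPP; split=> [H j|H x x1].
  pose x : 'cV[R]_N := delta_mx j 0.
  have xE i : x i 0 = (i == j)%:R by rewrite mxE eqxx andbT.
  have x1 : sparse 1 x.
    rewrite /sparse -[leqRHS](card1 j); apply: subset_leq_card.
    apply/fintype.subsetP => i; rewrite !inE xE.
    by rewrite pnatr_eq0 eqb0 negbK.
  have nx : normcv x ^+ 2 = 1.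
    rewrite normcv_sqr (bigD1 j) //= xE eqxx big1 ?expr1n ?addr0 // => i.
    by rewrite xE => /negPf ->; rewrite expr0n.
  have := H x x1; rewrite normcv_mulmx_diag nx mulr1.
  rewrite (bigD1 j) //= xE eqxx expr1n mul1r big1 => [|i /negPf ij]; last first.
    by rewrite xE ij expr0n mul0r.
  rewrite addr0 big1 ?addr0 // => i _; rewrite big1 // => k.
  rewrite !xE; case: (i =P j) => [->|_ _]; last by rewrite !mul0r.
  by move=> /negPf ->; rewrite mulr0 mul0r.
rewrite normcv_mulmx_diag [X in _ + X]big1 ?addr0; first exact: diag_bound.
move=> i _; apply: big1 => j ji.
have [->|xi] := eqVneq (x i 0) 0; first by rewrite !mul0r.
have [->|xj] := eqVneq (x j 0) 0; first by rewrite mulr0 mul0r.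
have : (#|[set i; j]%SET| <= 1)%N.
  apply: leq_trans x1; apply: subset_leq_card; apply/fintype.subsetP => k.
  by rewrite !inE => /orP[] /eqP ->.
by rewrite cards2 eq_sym ji.
Qed.

(** The infimum is meaningful because the set is nonempty and, some column existing, bounded below
    by [0]. Each column deviation is a lower bound of the set, and [t] is a member once it dominates
    them all. *)
Lemma ric1_leP Phi t : (0 < N)%N ->
  ric Phi 1 <= t <-> forall j, `|gram Phi j j - 1| <= t.
Proof.
move=> N0; pose j0 := Ordinal N0.
have lb : lbound [set delta : R | has_RIP Phi 1 delta] 0.
  by move=> e /= /has_RIP1P /(_ j0); exact: le_trans.
split=> [H j|H].
  apply: le_trans H; apply: lb_le_inf.
    exists (\sum_i `|gram Phi i i - 1|); apply/has_RIP1P => i.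
    by rewrite (bigD1 i) //= lerDl sumr_ge0.
  by move=> e /= /has_RIP1P.
by apply: ge_inf; [exists 0 | apply/has_RIP1P].
Qed.

(** The constant is [32 = 4 * 16 / 2]: [4] from decoupling, [16] from [flat_bilinear], and a half
    because the two arguments of the bilinear form share the norm of [x]. *)
Lemma flat_RO_RIP Phi K theta eta : 0 <= theta ->
  has_flat_RO Phi K theta -> (forall j, `|gram Phi j j - 1| <= eta) ->
  has_RIP Phi (2 * K) (eta + 32 * (1 + ln ((2 * K).+1%:R : R)) * theta).
Proof.
move=> t0 flat He; apply/has_RIPP => x xK.
rewrite normcv_mulmx_diag mulrDl; apply: le_trans (ler_normD _ _) _.
apply: lerD; first exact: diag_bound.
set h := 1 + _.
have h0 : 0 <= h by rewrite addr_ge0 ?ln_ge0 ?ler1n.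
have -> : 32 * h * theta * normcv x ^+ 2 =
  4 * (16 * h * theta * (normcv x ^+ 2 / 2)) by field.
apply: decoupling => A.
pose S := [set i | x i 0 != 0]%SET.
have SK : (#|S| <= 2 * K)%N by rewrite cardsE.
have supp (B : {set 'I_N}) (F : 'I_N -> R) :
    (forall i, x i 0 = 0 -> F i = 0) ->
    \sum_(i in B) F i = \sum_(i in B :&: S) F i.
  move=> F0; rewrite (big_setID S) /= [X in _ + X]big1 ?addr0 // => i.
  by rewrite !inE negbK => /andP[/eqP/F0].
rewrite supp => [|i ->]; last by rewrite big1 // => j _; rewrite !mul0r.
under eq_bigr => i _ do
  (rewrite supp; last by move=> j ->; rewrite mulr0 mul0r).
apply: le_trans (flat_bilinear (K := K) (c := theta) _ _ t0 _ _ _) _.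
- exact: leq_trans (subset_leq_card (finset.subsetIr _ _)) SK.
- exact: leq_trans (subset_leq_card (finset.subsetIr _ _)) SK.
- move=> B C BA CA BK CK; rewrite -dotcv_sum_col; apply: flat => //.
  rewrite -setI_eq0 -finset.subset0; apply/fintype.subsetP => i.
  rewrite !inE => /andP[/(fintype.subsetP BA)]; rewrite inE => /andP[iA _].
  by move=> /(fintype.subsetP CA); rewrite !inE iA.
- rewrite ler_wpM2l ?mulr_ge0 //.
  set p := Num.sqrt _; set q := Num.sqrt _.
  (* [p] and [q] are the norms of [x] on [A] and on its complement; [p q <= (p^2 + q^2) / 2] then
     gives the half. *)
  have : p ^+ 2 + q ^+ 2 <= normcv x ^+ 2.
    rewrite normcv_sqr /p /q !sqr_sqrtr ?sum_sqr_ge0 //.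
    rewrite -!supp; try by move=> i ->; rewrite expr0n.
    rewrite [leRHS](bigID (mem A)) /= lerD2l le_eqVlt; apply/orP; left.
    by apply/eqP; apply: eq_bigl => i; rewrite !inE.
  have := sqr_ge0 (p - q); lra.
Qed.

End RIP.

(** * Independent families *)

Section Independence.
Context {R : realType}.

Definition rectangle (I : Type) (A : I -> set R) : set (I -> R) :=
  [set x | forall i, A i (x i)].

Definition rectangles (I : Type) : set (set (I -> R)) :=
  [set B | exists2 A : I -> set R, (forall i, measurable (A i)) & B = rectangle A].

(** For finite [I] this is the product sigma-algebra; its generators are closed under intersection,
    so probability measures agreeing on rectangles coincide. *)
Definition cylType (I : Type) : measurableType _ :=
  g_sigma_algebraType (@rectangles I).

Lemma setI_closed_rectangles (I : Type) : setI_closed (@rectangles I).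
Proof.
move=> _ _ [A mA ->] [B mB ->]; exists (fun i => A i `&` B i).
  by move=> i; exact: measurableI.
rewrite predeqE => x; split=> [[xA xB] i|xAB]; first by split.
by split=> i; case: (xAB i).
Qed.

Lemma measurable_coord (I : eqType) (i : I) :
  measurable_fun setT (fun x : cylType I => x i).
Proof.
move=> _ A mA; rewrite setTI; apply: sub_sigma_algebra.
exists (fun j => if j == i then A else setT).
  by move=> j; case: ifP => // _; exact: measurableT.
rewrite predeqE => x; split=> /= [xA j|/(_ i)]; last by rewrite eqxx.
by case: eqP => // ->.
Qed.

Lemma measurable_to_cyl d (T : measurableType d) (I : finType)
    (f : T -> cylType I) :
  (forall i, measurable_fun setT (fun w => f w i)) -> measurable_fun setT f.
Proof.
move=> mf; apply: (measurability (rT := cylType I) (@rectangles I)) => //.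
move=> _ [_ [A mA ->] <-]; rewrite setTI.
have -> : f @^-1` rectangle A = \big[setI/setT]_(i : I) [set w | A i (f w i)].
  rewrite -bigcap_seq predeqE => w; split=> [H i _|H i]; first exact: H.
  by apply: H; rewrite /= mem_index_enum.
apply: bigsetI_measurable => i _.
by rewrite -[X in measurable X]setTI; exact: mf.
Qed.

Context {d : measure_display} {T : measurableType d} (P : probability T R).
Context {I : finType} (X : I -> {RV P >-> R}).

Definition sample (w : T) : cylType I := fun i => X i w.

Lemma measurable_sample : measurable_fun setT sample.
Proof. by apply: measurable_to_cyl => i; exact: measurable_funPT. Qed.

(* Independence of the coordinates in [A] from the others is expressed by reading
   them off two independent copies of the sample point. *)
Definition splice (A : {set I}) (z : T * T) : cylType I :=
  fun i => if i \in A then X i z.1 else X i z.2.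

Lemma measurable_splice A : measurable_fun setT (splice A).
Proof.
apply: measurable_to_cyl => i; rewrite /splice; case: (i \in A).
  exact: measurableT_comp (measurable_funPT (X i)) measurable_fst.
exact: measurableT_comp (measurable_funPT (X i)) measurable_snd.
Qed.

Hypothesis indX : mutually_independent X.

(** It suffices to compare rectangles. There the product measure splits into the coordinates in [A]
    and those outside, and independence turns both sides into the same product over [I]. *)
Lemma splice_law A (E : set (cylType I)) : measurable E ->
  pushforward P sample E = pushforward (P \x P)%E (splice A) E.
Proof.
pose m1 : {measure set (cylType I) -> \bar R} := pushforward P sample.
pose m2 : {measure set (cylType I) -> \bar R} := pushforward (P \x P)%E (splice A).
move=> mE; rewrite -[LHS]/(m1 measurable_sample E).
rewrite -[RHS]/(m2 (measurable_splice A) E).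
apply: (measure_unique (T := cylType I) (@rectangles I) (fun=> setT)) => //.
- exact: setI_closed_rectangles.
- by move=> _; exists (fun=> setT) => //; rewrite predeqE.
- by rewrite bigcup_const.
- move=> _ [B mB ->] /=; rewrite /m1 /m2 /= /pushforward /=.
  have mX i : measurable (X i @^-1` B i).
    by rewrite -[X in measurable X]setTI; exact: measurable_funPT.
  have indS (S : {set I}) : measurable [set w | forall i, i \in S -> B i (X i w)].
    have -> : [set w | forall i, i \in S -> B i (X i w)] =
        \big[setI/setT]_(i in S) (X i @^-1` B i).
      rewrite -big_enum -bigcap_seq predeqE => w; split=> H i.
        by rewrite /= mem_enum; exact: H.
      by move=> iS; apply: H; rewrite /= mem_enum.
    by apply: bigsetI_measurable => i _.
  have -> : splice A @^-1` rectangle B =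
    [set w | forall i, i \in A -> B i (X i w)] `*`
    [set w | forall i, i \in ~: A -> B i (X i w)].
    rewrite predeqE /splice /rectangle => -[w1 w2] /=; split=> [H|[H1 H2] i].
      split=> i; first by move=> iA; have := H i; rewrite iA.
      by rewrite inE => /negPf iA; have := H i; rewrite iA.
    by case: ifPn => iA; [exact: H1 | apply: H2; rewrite inE].
  rewrite product_measure1E //.
  have -> : sample @^-1` rectangle B =
      [set w | forall i, i \in [set: I]%SET -> B i (X i w)].
    by rewrite predeqE => w; split=> H i //; apply: H; rewrite inE.
  have iS S := indX (J := S) (fun i _ => mB i).
  transitivity ((\prod_(i in A) P [set w | B i (X i w)]) *
                (\prod_(i in ~: A) P [set w | B i (X i w)]))%E.
    rewrite iS (bigID (mem A)) /=.
    by congr (_ * _)%E; apply: eq_bigl => i; rewrite !inE.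
  exact: (congr2 mule (esym (iS A)) (esym (iS (~: A)))).
- by move=> k; rewrite /m1 /= /pushforward preimage_setT probability_setT ltry.
Qed.

Lemma integral_splice (A : {set I}) (F : cylType I -> \bar R) :
  measurable_fun setT F -> (forall x, 0 <= F x)%E ->
  (\int[P]_w F (sample w) =
   \int[P]_w \int[P]_w' F (splice A (w, w')))%E.
Proof.
move=> mF F0.
have mFs : measurable_fun setT (F \o splice A).
  exact: measurableT_comp mF (measurable_splice A).
rewrite -(@fubini_tonelli1 _ _ _ _ _ P P _ mFs) => [|z]; last exact: F0.
transitivity (\int[pushforward P sample]_x F x)%E.
  by rewrite (ge0_integral_pushforward measurable_sample _ _ mF).
transitivity (\int[pushforward (P \x P) (splice A)]_x F x)%E; last first.
  by rewrite (ge0_integral_pushforward (measurable_splice A) _ _ mF).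
pose m1 : {measure set (cylType I) -> \bar R} := pushforward P sample.
pose m2 : {measure set (cylType I) -> \bar R} :=
  pushforward (P \x P)%E (splice A).
apply: (@eq_measure_integral _ _ _ setT (m2 (measurable_splice A))
  (m1 measurable_sample)) => E mE _.
exact: splice_law.
Qed.

(** After splicing, [F] sees only the first copy and [G] only the second, so the iterated integral
    factors. *)
Lemma integral_indep_mul (A : {set I}) (F G : cylType I -> R) :
  measurable_fun setT F -> measurable_fun setT G ->
  (forall x, 0 <= F x) -> (forall x, 0 <= G x) ->
  (forall x y : cylType I, (forall i, i \in A -> x i = y i) -> F x = F y) ->
  (forall x y : cylType I, (forall i, i \notin A -> x i = y i) -> G x = G y) ->
  (\int[P]_w (F (sample w) * G (sample w))%:E =
   (\int[P]_w (F (sample w))%:E) * (\int[P]_w (G (sample w))%:E))%E.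
Proof.
move=> mF mG F0 G0 FA GA.
rewrite (integral_splice A (F := fun x => (F x * G x)%:E)).
- have FE w w' : F (splice A (w, w')) = F (sample w).
    by apply: FA => i iA; rewrite /splice iA.
  have GE w w' : G (splice A (w, w')) = G (sample w').
    by apply: GA => i iA; rewrite /splice (negPf iA).
  have mGs : measurable_fun setT (fun w => (G (sample w))%:E).
    apply/measurable_EFinP; exact: measurableT_comp mG measurable_sample.
  have mFs : measurable_fun setT (fun w => (F (sample w))%:E).
    apply/measurable_EFinP; exact: measurableT_comp mF measurable_sample.
  have int0 : (0 <= \int[P]_w (G (sample w))%:E)%E.
    by apply: integral_ge0 => w _; rewrite lee_fin.
  rewrite -ge0_integralZr //; last by move=> w _; rewrite lee_fin.
  apply: eq_integral => w _.
  rewrite -ge0_integralZl ?lee_fin //; last by move=> w' _; rewrite lee_fin.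
  by apply: eq_integral => w' _; rewrite FE GE EFinM.
- exact/measurable_EFinP/measurable_funM.
- by move=> x; rewrite lee_fin mulr_ge0.
Qed.

(** The labels cut the coordinates into blocks, and [F l] depends on block [l] alone. Induction
    peels off one block at a time; [uniq s] keeps it out of the remaining product. Blocks are later
    single entries or whole rows. *)
Lemma integral_indep_prod (L : eqType) (lab : I -> L) (s : seq L)
    (F : L -> cylType I -> R) : uniq s ->
  (forall l, measurable_fun setT (F l)) -> (forall l x, 0 <= F l x) ->
  (forall l (x y : cylType I), (forall i, lab i = l -> x i = y i) ->
    F l x = F l y) ->
  (\int[P]_w (\prod_(l <- s) F l (sample w))%:E =
   \prod_(l <- s) \int[P]_w (F l (sample w))%:E)%E.
Proof.
move=> us mF F0 FA; elim: s us => [_|l s IHs /= /andP[ls us]].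
  under eq_integral do rewrite big_nil.
  by rewrite big_nil integral_cst // mul1e; exact: probability_setT.
rewrite big_cons -IHs //; under eq_integral do rewrite big_cons.
pose G (x : cylType I) := \prod_(l' <- s) F l' x.
have mG : measurable_fun setT G by exact: measurable_prod.
apply: (integral_indep_mul (A := [set i | lab i == l]%SET) (mF l) mG (F0 l)).
- by move=> x; apply: prodr_ge0.
- by move=> x y xy; apply: FA => i il; apply: xy; rewrite inE il.
- move=> x y xy; rewrite /G big_seq [RHS]big_seq; apply: eq_bigr => l' l's.
  apply: FA => i il; apply: xy; rewrite inE il.
  by apply: contraNneq ls => <-.
Qed.

End Independence.

(** * Gaussian moment generating functions *)

Section NormalMoments.
Context {R : realType}.
Local Notation mu := (@lebesgue_measure R).

(** The Radon-Nikodym derivative of [normal_prob] has the same integrals over measurable sets as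
    [normal_pdf], so the two agree almost everywhere. *)
Lemma ge0_integral_normal_prob (m s : R) (f : R -> \bar R) :
  measurable_fun setT f -> (forall x, 0 <= f x)%E ->
  (\int[normal_prob m s]_x f x = \int[mu]_x (f x * (normal_pdf m s x)%:E))%E.
Proof.
move=> mf f0.
have dom := normal_prob_dominates m s.
have mpdf : measurable_fun setT (fun x => (normal_pdf m s x)%:E).
  by apply/measurable_EFinP; exact: measurable_normal_pdf.
have mRN : measurable_fun setT
    (Radon_Nikodym_SigmaFinite.f (normal_prob m s) mu).
  apply: (measurable_int mu); exact: Radon_Nikodym_SigmaFinite.f_integrable.
rewrite -(Radon_Nikodym_SigmaFinite.change_of_variables dom) //.
apply: ae_eq_integral => //.
- exact: emeasurable_funM.
- exact: emeasurable_funM.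
- apply: ae_eqe_mul2l.
  apply: integral_ae_eq => //.
    exact: Radon_Nikodym_SigmaFinite.f_integrable dom.
  by move=> A _ mA; rewrite -Radon_Nikodym_SigmaFinite.f_integral.
Qed.

(** Completing the square brings the Gaussian integrals below to this form: a constant times another
    normal density. *)
Lemma integral_scaled_normal (m s k : R) (f : R -> R) : 0 <= k ->
  (forall x, f x = k * normal_pdf m s x) ->
  (\int[mu]_x (f x)%:E = k%:E)%E.
Proof.
move=> k0 fE; under eq_integral do rewrite fE EFinM.
rewrite ge0_integralZl ?lee_fin //.
- by rewrite integral_normal_pdf mule1.
- by apply/measurable_EFinP; exact: measurable_normal_pdf.
- by move=> x _; rewrite lee_fin normal_pdf_ge0.
Qed.

(** The tilted density is a multiple of the normal density with mean [w s^2] and the same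
    deviation. *)
Lemma normal_mgf (s w : R) : s != 0 ->
  (\int[normal_prob 0 s]_x (expR (w * x))%:E =
   (expR (w ^+ 2 * s ^+ 2 / 2))%:E)%E.
Proof.
move=> s0; rewrite ge0_integral_normal_prob //.
- under eq_integral do rewrite -EFinM.
  apply: (@integral_scaled_normal (w * s ^+ 2) s) => [|x].
    exact: expR_ge0.
  rewrite !normal_pdfE // /normal_fun mulrCA [RHS]mulrCA; congr (_ * _).
  by rewrite -!expRD; congr expR; rewrite -mulr_natr; field.
- by apply/measurable_EFinP/measurableT_comp => //; exact: measurable_funM.
Qed.

Lemma normal_peak_div (s r : R) : 0 < r ->
  normal_peak (s / r) = r * normal_peak s.
Proof.
move=> r0; rewrite /normal_peak.
have -> : (s / r) ^+ 2 * pi *+ 2 = (s ^+ 2 * pi *+ 2) * (r ^+ 2)^-1.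
  by rewrite expr_div_n mulrAC mulrnAl.
rewrite [X in X^-1 = _]sqrtrM; last first.
  by rewrite mulrn_wge0 // mulr_ge0 ?sqr_ge0 ?pi_ge0.
by rewrite sqrtrV ?sqr_ge0 // sqrtr_sqr gtr0_norm // invfM invrK mulrC.
Qed.

(** With [r^2 = 1 - 2 c s^2], the integrand is [1 / r] times the centered normal density of
    deviation [s / r]. *)
Lemma normal_sqr_mgf (s c : R) : s != 0 -> 2 * c * s ^+ 2 < 1 ->
  (\int[normal_prob 0 s]_x (expR (c * x ^+ 2))%:E =
   (Num.sqrt (1 - 2 * c * s ^+ 2))^-1%:E)%E.
Proof.
move=> s0 cs; set r := Num.sqrt _.
have r0 : 0 < r by rewrite sqrtr_gt0 subr_gt0.
have rr : r ^+ 2 = 1 - 2 * c * s ^+ 2 by rewrite sqr_sqrtr // subr_ge0 ltW.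
have rn : r != 0 by rewrite gt_eqF.
have peak := normal_peak_div s r0.
have sr0 : s / r != 0 by rewrite mulf_neq0 // invr_eq0.
clearbody r.
rewrite ge0_integral_normal_prob //.
- under eq_integral do rewrite -EFinM.
  apply: (@integral_scaled_normal 0 (s / r)) => [|x].
    by rewrite invr_ge0 ltW.
  rewrite !normal_pdfE // /normal_fun mulrCA [RHS]mulrA; congr (_ * _).
    by rewrite peak mulrA mulVf // mul1r.
  rewrite -expRD subr0 -(mulr_natr (s ^+ 2)) -(mulr_natr ((s / r) ^+ 2)) expr_div_n.
  congr expR.
  have -> : - x ^+ 2 / (s ^+ 2 / r ^+ 2 * 2) = - x ^+ 2 * r ^+ 2 / (s ^+ 2 * 2).
    by field; rewrite s0.
  by rewrite rr; field.
- apply/measurable_EFinP/measurableT_comp => //; apply: measurable_funM => //.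
Qed.

End NormalMoments.

(** * Moment generating functions of independent normal families *)

Section NormalFamily.
Context {R : realType} {d : measure_display} {T : measurableType d}.
Context (P : probability T R) {I : finType} (X : I -> {RV P >-> R}) (s : R).
Hypothesis s0 : s != 0.
Hypothesis indX : mutually_independent X.
Hypothesis lawX :
  forall i A, measurable A -> distribution P (X i) A = normal_prob 0 s A.

Lemma measurable_sum_coord (J : finType) (S : {set I}) (f : I -> J) :
  measurable_fun setT (fun x : cylType J => \sum_(i in S) x (f i) : R).
Proof.
rewrite (_ : (fun x => _) = (fun x : cylType J => \sum_(i <- enum S) x (f i))).
  by apply: measurable_sum => i; exact: measurable_coord.
by apply/funext => x; rewrite big_enum.
Qed.

(* The library equips [R] and [measurableTypeR R] with two structures that have
   the same measurable sets but distinct displays, and [normal_prob] lives on the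
   second one: the identity transports it. *)
Lemma integral_entry i (f : R -> \bar R) :
  measurable_fun setT f -> (forall x, 0 <= f x)%E ->
  (\int[P]_w f (X i w) = \int[normal_prob 0 s]_x f x)%E.
Proof.
move=> mf f0; rewrite -[LHS](ge0_integral_distribution (X i)) //.
pose idTR : measurableTypeR R -> R := idfun.
have mid : measurable_fun setT idTR by exact: measurable_id.
transitivity (\int[pushforward (normal_prob 0 s) idTR]_x f x)%E; last first.
  by rewrite (ge0_integral_pushforward mid _ _ mf).
pose m1 : {measure set R -> \bar R} := distribution P (X i).
pose m2 : {measure set R -> \bar R} := pushforward (normal_prob 0 s) idTR.
exact: (@eq_measure_integral _ R R setT (m2 mid) m1 f (fun A mA _ => lawX i mA)).
Qed.

(** Independence with one block per entry ([lab := id]) reduces this to [normal_mgf]. *)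
Lemma mgf_linear (S : {set I}) (a : I -> R) :
  (\int[P]_w (expR (\sum_(i in S) a i * X i w))%:E =
   (expR ((\sum_(i in S) a i ^+ 2) * s ^+ 2 / 2))%:E)%E.
Proof.
pose F i (x : cylType I) := expR (a i * x i).
have mF i : measurable_fun setT (F i).
  apply: measurableT_comp => //; apply: measurable_funM => //.
  exact: measurable_coord.
transitivity (\int[P]_w (\prod_(i <- enum S) F i (sample X w))%:E)%E.
  by apply: eq_integral => w _; rewrite big_enum expR_sum.
rewrite (integral_indep_prod indX (lab := id)) ?enum_uniq //.
- rewrite big_enum /= !mulr_suml expR_sum -prodEFin.
  apply: eq_bigr => i _.
  rewrite -[RHS](normal_mgf _ s0).
  apply: (integral_entry i (f := fun x => (expR (a i * x))%:E)) => [|x].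
    by apply/measurable_EFinP/measurableT_comp => //; exact: measurable_funM.
  by rewrite lee_fin expR_ge0.
- by move=> l x; exact: expR_ge0.
- by move=> l x y xy; rewrite /F xy.
Qed.

(* [exp (c V^2)] is the average of [exp (sqrt (2 c) g V)] over a standard
   normal [g]; after exchanging the integrals only linear forms in the family
   are left. *)
Lemma mgf_sqr_sum (S : {set I}) (c : R) : 0 <= c ->
  2 * c * (#|S|%:R * s ^+ 2) < 1 ->
  (\int[P]_w (expR (c * (\sum_(i in S) X i w) ^+ 2))%:E =
   (Num.sqrt (1 - 2 * c * (#|S|%:R * s ^+ 2)))^-1%:E)%E.
Proof.
move=> c0 cS.
pose V w := \sum_(i in S) X i w.
have mV : measurable_fun setT V.
  exact: measurableT_comp (measurable_sum_coord S id) (measurable_sample X).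
pose f (z : T * measurableTypeR R) : \bar R :=
  (expR (Num.sqrt (2 * c) * V z.1 * z.2))%:E.
have mf : measurable_fun setT f.
  apply/measurable_EFinP/measurableT_comp => //; apply: measurable_funM => //.
  by apply: measurable_funM => //; exact: measurableT_comp mV measurable_fst.
have f0 z : (0 <= f z)%E by rewrite lee_fin expR_ge0.
have c2 : Num.sqrt (2 * c) ^+ 2 = 2 * c by rewrite sqr_sqrtr // mulr_ge0.
transitivity (\int[P]_w \int[normal_prob 0 1]_g f (w, g))%E.
  apply: eq_integral => w _; rewrite -/(V w).
  have := normal_mgf (Num.sqrt (2 * c) * V w) (oner_neq0 R).
  rewrite exprMn c2 (_ : 2 * c * V w ^+ 2 * 1 ^+ 2 / 2 = c * V w ^+ 2).
    by move=> <-.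
  by move: (V w) => v; field.
rewrite (@fubini_tonelli _ _ T (measurableTypeR R) R P (normal_prob 0 1) f mf f0).
(* For fixed [g], [mgf_linear] integrates out the family and leaves the exponential of a multiple of
   [g^2], again within reach of [normal_sqr_mgf]. *)
transitivity (\int[normal_prob 0 1]_g
  (expR (c * (#|S|%:R * s ^+ 2) * g ^+ 2))%:E)%E.
  apply: eq_integral => g _; rewrite /fubini_G.
  transitivity (\int[P]_w
      (expR (\sum_(i in S) (Num.sqrt (2 * c) * g) * X i w))%:E)%E.
    apply: eq_integral => w _; rewrite /f /= -mulr_sumr -/(V w).
    by rewrite mulrAC.
  rewrite mgf_linear sumr_const (exprMn _ (Num.sqrt _)) c2 -[_ *+ #|_|]mulr_natl.
  by rewrite [X in expR X](_ : _ = c * (#|S|%:R * s ^+ 2) * g ^+ 2) //; field.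
have e : 2 * (c * (#|S|%:R * s ^+ 2)) * 1 ^+ 2 = 2 * c * (#|S|%:R * s ^+ 2).
  by ring.
rewrite -[X in 1 - X]e; apply: normal_sqr_mgf; first exact: oner_neq0.
by rewrite e.
Qed.

(** Splicing along [B] freezes the second sum at a value [V]. Integrating the first by [mgf_linear]
    leaves [exp (c V^2)] with [c = lam^2 |A| s^2 / 2], which [mgf_sqr_sum] evaluates. *)
Lemma mgf_mul_sum (A B : {set I}) (lam : R) : [disjoint A & B]%B ->
  lam ^+ 2 * (#|A|%:R * #|B|%:R) * s ^+ 4 < 1 ->
  (\int[P]_w (expR (lam * ((\sum_(i in A) X i w) * (\sum_(j in B) X j w))))%:E =
   (Num.sqrt (1 - lam ^+ 2 * (#|A|%:R * #|B|%:R) * s ^+ 4))^-1%:E)%E.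
Proof.
move=> dAB lAB.
pose F (x : cylType I) : \bar R :=
  (expR (lam * ((\sum_(i in A) x i) * (\sum_(j in B) x j))))%:E.
have mF : measurable_fun setT F.
  apply/measurable_EFinP/measurableT_comp => //; apply: measurable_funM => //.
  by apply: measurable_funM; exact: (measurable_sum_coord _ id).
rewrite [LHS](integral_splice indX B mF); last first.
  by move=> x; rewrite lee_fin expR_ge0.
set c := lam ^+ 2 * #|A|%:R * s ^+ 2 / 2.
have c0 : 0 <= c.
  apply: divr_ge0 => //; apply: mulr_ge0; last exact: sqr_ge0.
  by apply: mulr_ge0; [exact: sqr_ge0 | exact: ler0n].
have e : 2 * c * (#|B|%:R * s ^+ 2) = lam ^+ 2 * (#|A|%:R * #|B|%:R) * s ^+ 4.
  by rewrite /c; field.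
rewrite -e -mgf_sqr_sum ?e //; apply: eq_integral => w _.
set V := \sum_(i in B) X i w.
transitivity (\int[P]_w' (expR (\sum_(i in A) (lam * V) * X i w'))%:E)%E.
  apply: eq_integral => w' _; rewrite /F /splice -mulr_sumr.
  congr (expR _)%:E; rewrite mulrAC -mulrA; congr (_ * (_ * _)).
    apply: eq_bigr => i iA; rewrite ifF //.
    exact: (disjointFr dAB iA).
  by apply: eq_bigr => i iB; rewrite iB.
rewrite mgf_linear sumr_const (exprMn _ lam) -[_ *+ #|_|]mulr_natl /c; clearbody V.
by rewrite [X in expR X](_ : _ = lam ^+ 2 * #|A|%:R * s ^+ 2 / 2 * V ^+ 2) //; field.
Qed.

End NormalFamily.

(** * Tail bounds *)

Section TailBounds.
Context {R : realType}.

Lemma inv_sqrt_le_expR (u y : R) : expR (- y) <= 1 - u ->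
  (Num.sqrt (1 - u))^-1 <= expR (y / 2).
Proof.
move=> yu.
have e : expR (- y) = (expR (y / 2))^-1 ^+ 2.
  by rewrite -expRN expr2 -expRD; congr expR; field.
rewrite -[leRHS]invrK lef_pV2 ?posrE ?invr_gt0 ?expR_gt0 ?sqrtr_gt0 //; last first.
  exact: lt_le_trans (expR_gt0 _) yu.
rewrite -[leLHS]ger0_norm ?invr_ge0 ?expR_ge0 // -sqrtr_sqr -e ler_sqrt //.
exact: le_trans (expR_ge0 _) yu.
Qed.

(** Take [y = 4u/3]: [(1 + 4u/3) (1 - u) = 1 + u (1 - 4u) / 3 >= 1], and [exp y >= 1 + y]. *)
Lemma inv_sqrt_le_quarter (u : R) : 0 <= u <= 4^-1 ->
  (Num.sqrt (1 - u))^-1 <= expR (2 * u / 3).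
Proof.
move=> /andP[u0 u1].
rewrite (_ : 2 * u / 3 = (4 * u / 3) / 2); last by field.
apply: inv_sqrt_le_expR; rewrite expRN -[leRHS]invrK lef_pV2 ?posrE ?expR_gt0 //;
  last by rewrite invr_gt0; lra.
apply: le_trans (expR_ge1Dx _); rewrite invf_ple ?posrE; [|lra|lra].
by rewrite -[leLHS]div1r ler_pdivrMr; nra.
Qed.

(** For [y = v + v^2] the bound [exp y >= 1 + y] would only give [1 - v^3] after multiplication by
    [1 - v]; the sharper [exp y >= (1 + y/2)^2] gains a positive second-order term. *)
Lemma inv_sqrt_le_sqr (v : R) : - 4^-1 <= v <= 4^-1 ->
  (Num.sqrt (1 - v))^-1 <= expR ((v + v ^+ 2) / 2).
Proof.
move=> /andP[v0 v1]; apply: inv_sqrt_le_expR.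
set y := v + v ^+ 2.
have y1 : 0 <= 1 + y / 2 by rewrite /y; nra.
have ey : (1 + y / 2) ^+ 2 <= expR y.
  rewrite (_ : expR y = expR (y / 2) ^+ 2); last first.
    by rewrite expr2 -expRD; congr expR; field.
  by rewrite ler_pXn2r ?nnegrE ?expR_ge0 // expR_ge1Dx.
rewrite expRN invf_ple ?posrE ?expR_gt0 //; last by lra.
apply: le_trans ey; rewrite -[leLHS]div1r ler_pdivrMr; last by lra.
have -> : (1 + y / 2) ^+ 2 * (1 - v) =
  1 + v ^+ 2 * ((1 - 3 * v - v ^+ 2 - v ^+ 3) / 4) by rewrite /y; field.
rewrite lerDl mulr_ge0 ?sqr_ge0 // divr_ge0 //.
have -> : v ^+ 3 = v ^+ 2 * v by rewrite exprSr.
nra.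
Qed.

Context {d : measure_display} {T : measurableType d} (P : probability T R).

Lemma exp_markov (Z : T -> R) (a : R) : measurable_fun setT Z ->
  (P [set w | (a <= Z w)%R] <= (\int[P]_w (expR (Z w))%:E) * (expR (- a))%:E)%E.
Proof.
move=> mZ; pose Y : {RV P >-> R} := HB.pack Z (isMeasurableFun.Build _ _ _ _ Z mZ).
have := chernoff Y a ltr01; rewrite /mmt_gen_fun unlock mul1r.
rewrite (_ : (\int[P]_w _)%E = (\int[P]_w (expR (Z w))%:E)%E) //.
by apply: eq_integral => w _ /=; rewrite mulr1.
Qed.

Context {M N : nat} (Phi : 'I_M -> 'I_N -> {RV P >-> R}).
Hypothesis M0 : (0 < M)%N.
Hypothesis iidPhi : iid_normal Phi 0 M%:R^-1.

Let s : R := Num.sqrt (M%:R^-1).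
Let X (p : 'I_M * 'I_N) := Phi p.1 p.2.

Let ss : s ^+ 2 = M%:R^-1. Proof. by rewrite sqr_sqrtr // invr_ge0. Qed.
Let s0 : s != 0. Proof. by rewrite gt_eqF // sqrtr_gt0 invr_gt0 ltr0n. Qed.
Let indX : mutually_independent X. Proof. by case: iidPhi. Qed.
Let lawX p A : measurable A -> distribution P (X p) A = normal_prob 0 s A.
Proof. by move=> mA; case: iidPhi => _ /(_ p.1 p.2) /(_ _ mA). Qed.

(** The inner product is written as a sum over rows because the rows are independent. *)
Definition flat_dot (I J : {set 'I_N}) (w : T) : R :=
  \sum_m (\sum_(i in I) Phi m i w) * (\sum_(j in J) Phi m j w).

(** One block per row ([lab := fst]) gives [M] equal factors, each an instance of [mgf_mul_sum] on
    the entries of that row. *)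
Lemma mgf_flat_dot (I J : {set 'I_N}) (lam : R) : [disjoint I & J]%B ->
  lam ^+ 2 * (#|I|%:R * #|J|%:R) * M%:R ^- 2 < 1 ->
  (\int[P]_w (expR (lam * flat_dot I J w))%:E =
   ((Num.sqrt (1 - lam ^+ 2 * (#|I|%:R * #|J|%:R) * M%:R ^- 2))^-1 ^+ M)%:E)%E.
Proof.
move=> dIJ lIJ.
pose F (m : 'I_M) (x : cylType ('I_M * 'I_N)%type) : R :=
  expR (lam * ((\sum_(i in I) x (m, i)) * (\sum_(j in J) x (m, j)))).
have mF m : measurable_fun setT (F m).
  apply: measurableT_comp => //; apply: measurable_funM => //.
  by apply: measurable_funM; exact: measurable_sum_coord.
transitivity (\int[P]_w (\prod_(m <- index_enum 'I_M) F m (sample X w))%:E)%E.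
  by apply: eq_integral => w _; rewrite /flat_dot mulr_sumr expR_sum.
have s4 : s ^+ 4 = M%:R ^- 2 by rewrite (exprM s 2 2) ss exprVn.
rewrite (integral_indep_prod indX (lab := fst)) ?index_enum_uniq //.
- rewrite (eq_bigr (fun=> ((Num.sqrt (1 - lam ^+ 2 * (#|I|%:R * #|J|%:R) *
      M%:R ^- 2))^-1)%:E)) => [|m _].
    by rewrite prodEFin prodr_const card_ord.
  have pinj : injective (fun i : 'I_N => (m, i)) by move=> i j [].
  pose A := [set (m, i) | i in I]%SET; pose B := [set (m, j) | j in J]%SET.
  have cA : #|A| = #|I| by rewrite card_imset.
  have cB : #|B| = #|J| by rewrite card_imset.
  have dAB : [disjoint A & B]%B.
    rewrite -setI_eq0 -imsetI ?imset_eq0 ?setI_eq0 //.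
    by move=> i j _ _; exact: pinj.
  rewrite -s4 -cA -cB -(mgf_mul_sum s0 indX lawX dAB) ?cA ?cB ?s4 //.
  apply: eq_integral => w _; rewrite /F /sample.
  by rewrite !big_imset //= => i j _ _; exact: pinj.
- by move=> m x; exact: expR_ge0.
- move=> m x y xy.
  have e (K : {set 'I_N}) : \sum_(i in K) x (m, i) = \sum_(i in K) y (m, i).
    by apply: eq_bigr => i _; exact: xy.
  by rewrite /F !e.
Qed.

Lemma mgf_col_sqr (j : 'I_N) (c : R) : 2 * c * M%:R^-1 < 1 ->
  (\int[P]_w (expR (c * \sum_m Phi m j w ^+ 2))%:E =
   ((Num.sqrt (1 - 2 * c * M%:R^-1))^-1 ^+ M)%:E)%E.
Proof.
move=> cM.
pose F (m : 'I_M) (x : cylType ('I_M * 'I_N)%type) : R := expR (c * x (m, j) ^+ 2).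
have mF m : measurable_fun setT (F m).
  apply: measurableT_comp => //; apply: measurable_funM => //.
  by apply: measurable_funX; exact: measurable_coord.
transitivity (\int[P]_w (\prod_(m <- index_enum 'I_M) F m (sample X w))%:E)%E.
  by apply: eq_integral => w _; rewrite mulr_sumr expR_sum.
rewrite (integral_indep_prod indX (lab := fst)) ?index_enum_uniq //.
- rewrite (eq_bigr (fun=> ((Num.sqrt (1 - 2 * c * M%:R^-1))^-1)%:E)) => [|m _].
    by rewrite prodEFin prodr_const card_ord.
  rewrite -ss -(normal_sqr_mgf s0) ?ss //.
  apply: (integral_entry lawX (m, j) (f := fun x => (expR (c * x ^+ 2))%:E)).
    apply/measurable_EFinP/measurableT_comp => //; apply: measurable_funM => //.
  by move=> x; rewrite lee_fin expR_ge0.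
- by move=> m x; exact: expR_ge0.
- by move=> m x y xy; rewrite /F xy.
Qed.

Lemma two_sided_markov (Z1 Z2 : T -> R) (A : set T) (a1 a2 b : R) :
  measurable_fun setT Z1 -> measurable_fun setT Z2 -> measurable A ->
  (forall w, A w -> a1 <= Z1 w \/ a2 <= Z2 w) ->
  ((\int[P]_w (expR (Z1 w))%:E) * (expR (- a1))%:E <= b%:E)%E ->
  ((\int[P]_w (expR (Z2 w))%:E) * (expR (- a2))%:E <= b%:E)%E ->
  (P A <= (2 * b)%:E)%E.
Proof.
move=> mZ1 mZ2 mA AZ b1 b2.
have mge (Z : T -> R) a : measurable_fun setT Z -> measurable [set w | a <= Z w].
  move=> mZ; rewrite (_ : [set w | _] = setT `&` Z @^-1` `[a, +oo[%classic).
    exact: mZ.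
  by rewrite setTI; apply/seteqP; split=> w /=; rewrite in_itv /= andbT.
apply: (@le_trans _ _ (P ([set w | a1 <= Z1 w] `|` [set w | a2 <= Z2 w]))).
  apply: le_measure; rewrite ?inE //.
    by apply: measurableU; exact: mge.
apply: (le_trans (measureU2 _ (mge _ a1 mZ1) (mge _ a2 mZ2))).
rewrite mulr_natl mulr2n EFinD; apply: leeD.
  exact: le_trans (exp_markov _ mZ1) b1.
exact: le_trans (exp_markov _ mZ2) b2.
Qed.

Lemma measurable_flat_dot (I J : {set 'I_N}) : measurable_fun setT (flat_dot I J).
Proof.
apply: measurable_sum => m; apply: measurable_funM.
  exact: measurableT_comp (measurable_sum_coord _ (fun i => (m, i)))
    (measurable_sample X).
exact: measurableT_comp (measurable_sum_coord _ (fun i => (m, i)))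
    (measurable_sample X).
Qed.

Lemma measurable_col_sqr (j : 'I_N) :
  measurable_fun setT (fun w => \sum_m Phi m j w ^+ 2).
Proof.
apply: measurable_sum => m; apply: measurable_funX.
exact: measurable_funPT.
Qed.

Lemma measurable_norm_gt (Z : T -> R) a : measurable_fun setT Z ->
  measurable [set w | a < `|Z w|].
Proof.
move=> mZ; rewrite (_ : [set w | _] = setT `&` (Num.norm \o Z) @^-1` `]a, +oo[%classic).
  by apply: measurableT_comp => //; exact: measurable_normr.
by rewrite setTI; apply/seteqP; split=> w /=; rewrite in_itv /= andbT.
Qed.

Lemma flat_dot_tail (I J : {set 'I_N}) (theta : R) : [disjoint I & J]%B ->
  (0 < #|I|)%N -> (0 < #|J|)%N -> 0 < theta -> theta <= 2^-1 ->
  (P [set w | (theta * Num.sqrt (#|I|%:R * #|J|%:R) < `|flat_dot I J w|)%R]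
    <= (2 * expR (- (M%:R * theta ^+ 2 / 3)))%:E)%E.
Proof.
move=> dIJ I0 J0 t0 t1.
set ab : R := #|I|%:R * #|J|%:R; set q := Num.sqrt ab.
have ab0 : 0 < ab by rewrite mulr_gt0 // ltr0n.
have q0 : 0 < q by rewrite sqrtr_gt0.
have qq : q ^+ 2 = ab by rewrite sqr_sqrtr // ltW.
have m0 : 0 < M%:R :> R by rewrite ltr0n.
(* This choice turns the term under the square root into [theta^2 <= 1/4] and the Markov threshold
   into [M theta^2]; the moment bound [2 M theta^2 / 3] leaves [- M theta^2 / 3]. *)
pose lam := M%:R * theta / q.
have lam0 : 0 < lam by rewrite divr_gt0 // mulr_gt0.
have th2 : lam ^+ 2 * ab * M%:R ^- 2 = theta ^+ 2.
  by rewrite -qq /lam; field; rewrite !gt_eqF.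
have lq : lam * (theta * q) = M%:R * theta ^+ 2.
  by rewrite /lam; field; rewrite gt_eqF.
have t2 : theta ^+ 2 <= 4^-1.
  by rewrite (_ : 4^-1 = 2^-1 ^+ 2) ?ler_pXn2r ?nnegrE ?invr_ge0 // ?ltW //; field.
(* Only [l^2] enters the moment generating function, so one bound serves both tails. *)
have bound (l : R) : l ^+ 2 = lam ^+ 2 ->
    ((\int[P]_w (expR (l * flat_dot I J w))%:E) *
     (expR (- (M%:R * theta ^+ 2)))%:E <=
     (expR (- (M%:R * theta ^+ 2 / 3)))%:E)%E.
  move=> l2; rewrite mgf_flat_dot //; last first.
    by rewrite l2 -/ab th2; lra.
  rewrite l2 -/ab th2 -EFinM lee_fin.
  rewrite (_ : - (M%:R * theta ^+ 2 / 3) =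
    M%:R * (2 * theta ^+ 2 / 3) + (- (M%:R * theta ^+ 2))); last by field.
  rewrite expRD ler_wpM2r ?expR_ge0 // expRM_natl.
  rewrite ler_pXn2r ?nnegrE ?expR_ge0 ?invr_ge0 ?sqrtr_ge0 //.
  by apply: inv_sqrt_le_quarter; rewrite sqr_ge0.
have mZ := measurable_flat_dot I J.
apply: (two_sided_markov (Z1 := fun w => lam * flat_dot I J w)
  (Z2 := fun w => (- lam) * flat_dot I J w)
  (a1 := M%:R * theta ^+ 2) (a2 := M%:R * theta ^+ 2)).
- exact: measurable_funM.
- exact: measurable_funM.
- exact: measurable_norm_gt.
- move=> w /=; rewrite -lq lter_normr => /orP[] /ltW h; [left|right].
    by rewrite ler_pM2l.
  by rewrite mulNr -mulrN ler_pM2l.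
- exact: bound.
- by apply: bound; rewrite sqrrN.
Qed.

Lemma col_sqr_tail (j : 'I_N) (t : R) : 0 < t -> t <= 2^-1 ->
  (P [set w | (t < `|\sum_m Phi m j w ^+ 2 - 1|)%R]
    <= (2 * expR (- (M%:R * t ^+ 2 / 8)))%:E)%E.
Proof.
move=> t0 t1.
have m0 : 0 < M%:R :> R by rewrite ltr0n.
(* Used with [v = t/2] and [v = - t/2]: the exponent is [M (v + v^2) / 2 - M (v + t^2/2) / 2 = - M
   t^2 / 8]. *)
have bound (v : R) : v ^+ 2 = t ^+ 2 / 4 -> - 4^-1 <= v <= 4^-1 ->
    ((\int[P]_w (expR (v / 2 * M%:R * \sum_m Phi m j w ^+ 2))%:E) *
     (expR (- (M%:R * (v + t ^+ 2 / 2) / 2)))%:E <=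
     (expR (- (M%:R * t ^+ 2 / 8)))%:E)%E.
  move=> v2 v4.
  have e : 2 * (v / 2 * M%:R) * M%:R^-1 = v by field; rewrite gt_eqF.
  rewrite mgf_col_sqr e -?EFinM ?lee_fin; last by case/andP: v4 => *; lra.
  rewrite (_ : - (M%:R * t ^+ 2 / 8) =
    M%:R * ((v + v ^+ 2) / 2) + (- (M%:R * (v + t ^+ 2 / 2) / 2)));
    last by rewrite v2; field.
  rewrite expRD ler_wpM2r ?expR_ge0 // expRM_natl.
  rewrite ler_pXn2r ?nnegrE ?expR_ge0 ?invr_ge0 ?sqrtr_ge0 //.
  exact: inv_sqrt_le_sqr.
have mZ := measurable_col_sqr j.
apply: (two_sided_markov
  (Z1 := fun w => (t / 2) / 2 * M%:R * \sum_m Phi m j w ^+ 2)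
  (Z2 := fun w => (- (t / 2)) / 2 * M%:R * \sum_m Phi m j w ^+ 2)
  (a1 := M%:R * (t / 2 + t ^+ 2 / 2) / 2)
  (a2 := M%:R * (- (t / 2) + t ^+ 2 / 2) / 2)).
- exact: measurable_funM.
- exact: measurable_funM.
- by apply: measurable_norm_gt; exact: measurable_funB.
- move=> w /=; set Y := \sum_m _; rewrite lter_normr => /orP[] /ltW h.
    left; rewrite (_ : _ / 2 = t / 2 / 2 * M%:R * (1 + t)); last by field.
    by rewrite ler_wpM2l ?mulr_ge0 ?divr_ge0 ?(ltW t0) ?(ltW m0) //; lra.
  right; rewrite (_ : M%:R * _ / 2 = t / 2 / 2 * M%:R * (t - 1)); last by field.
  rewrite !mulNr -mulrN.
  by rewrite ler_wpM2l ?mulr_ge0 ?divr_ge0 ?(ltW t0) ?(ltW m0) //; lra.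
- by apply: bound; [field | apply/andP; split; lra].
- by apply: bound; [field | apply/andP; split; lra].
Qed.

End TailBounds.

(** * The good event *)

Section Numerics.
Context {R : realType}.

(** [exp (-3/5) = exp (-1/10)^6 >= (9/10)^6 >= 1/2]. *)
Lemma ln2_ge : 3 / 5 <= ln (2 : R).
Proof.
rewrite -ler_expR lnK ?posrE // -[leRHS]invrK -[leLHS]invrK -expRN.
rewrite lef_pV2 ?posrE ?expR_gt0 ?invr_gt0 //.
have -> : - (3 / 5) = 6%:R * (- 10%:R^-1) :> R by field.
rewrite expRM_natl.
have h : (9 / 10 : R) <= expR (- 10%:R^-1).
  by apply: le_trans (expR_ge1Dx _); lra.
have h6 : (9 / 10 : R) ^+ 6 <= expR (- 10%:R^-1) ^+ 6.
  by rewrite ler_pXn2r ?nnegrE ?expR_ge0 //; lra.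
by apply: le_trans h6; rewrite !exprS expr0; lra.
Qed.

Lemma ln_nat_ge (K : nat) : (2 <= K)%N -> 3 / 5 <= ln (K%:R : R).
Proof.
move=> K2; apply: le_trans ln2_ge _; rewrite ler_ln ?posrE ?ltr0n ?ler_nat //.
exact: leq_trans K2.
Qed.

(** Here [150 = 2C]. Since [2K + 1 <= K^3], it remains that [32 <= 54 ln K], which [ln K >= 3/5]
    barely yields. *)
Lemma rip_log_bound (K : nat) : (2 <= K)%N ->
  32 * (1 + ln ((2 * K).+1%:R : R)) <= 150 * ln (K%:R : R).
Proof.
move=> K2; have := ln_nat_ge K2.
have K0 : (0 < K)%N by exact: leq_trans K2.
have : ln ((2 * K).+1%:R : R) <= 3 * ln (K%:R : R).
  rewrite mulr_natl -lnXn ?ltr0n // ler_ln ?posrE ?exprn_gt0 ?ltr0n //.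
  rewrite -natrX ler_nat; nia.
lra.
Qed.

(** The squared threshold cancels [delta], [C] and [L], leaving [33 * 0.99^2 / 12 > 5/2]. This
    exceeds the [2] coming from the count of [N^(2K)] pairs. *)
Lemma flat_exponent (m delta k L n : R) : 0 < delta -> 0 < L -> 0 <= k -> 0 <= n ->
  33%:R * 75%:R ^+ 2 / delta ^+ 2 * k * L ^+ 2 * n <= m ->
  5 / 2 * k * n <=
  m * ((1 - 100%:R^-1) * delta / (2%:R * 75%:R * L)) ^+ 2 / 3.
Proof.
move=> d0 L0 k0 n0 H; set th := (_ - _) * delta / _.
apply: (@le_trans _ _
  (33%:R * 75%:R ^+ 2 / delta ^+ 2 * k * L ^+ 2 * n * th ^+ 2 / 3)); last first.
  by rewrite ler_wpM2r ?invr_ge0 // ler_wpM2r ?sqr_ge0.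
have -> : 33%:R * 75%:R ^+ 2 / delta ^+ 2 * k * L ^+ 2 * n * th ^+ 2 / 3 =
    33%:R * (99%:R / 100%:R) ^+ 2 / 12%:R * (k * n).
  by rewrite /th; field; rewrite !gt_eqF.
rewrite -mulrA ler_wpM2r ?mulr_ge0 //; lra.
Qed.

(** Here [k L^2 >= 2 (3/5)^2] makes the coefficient about [1.67]; the surplus of [3/2] over [1]
    absorbs the union over [N] columns. *)
Lemma col_exponent (m delta k L n : R) : 0 < delta -> 3 / 5 <= L -> 2 <= k ->
  0 <= n -> 33%:R * 75%:R ^+ 2 / delta ^+ 2 * k * L ^+ 2 * n <= m ->
  3 / 2 * n <= m * (100%:R^-1 * delta) ^+ 2 / 8.
Proof.
move=> d0 L0 k2 n0 H.
apply: (@le_trans _ _ (33%:R * 75%:R ^+ 2 / delta ^+ 2 * k * L ^+ 2 * n *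
  (100%:R^-1 * delta) ^+ 2 / 8)); last first.
  by rewrite ler_wpM2r ?invr_ge0 // ler_wpM2r ?sqr_ge0.
have -> : 33%:R * 75%:R ^+ 2 / delta ^+ 2 * k * L ^+ 2 * n *
    (100%:R^-1 * delta) ^+ 2 / 8 =
    33%:R * 75%:R ^+ 2 / 80000%:R * (k * L ^+ 2) * n.
  by field; rewrite gt_eqF.
rewrite ler_wpM2r //.
have : 2 * (3 / 5) ^+ 2 <= k * L ^+ 2.
  by rewrite ler_pM // ?ler_pXn2r ?nnegrE //; lra.
lra.
Qed.

Lemma natr_expR_ln (N : nat) : (0 < N)%N -> N%:R = expR (ln (N%:R : R)).
Proof. by move=> N0; rewrite lnK // posrE ltr0n. Qed.

Lemma four_expR_half_ln (eps : R) (N : nat) : 0 < eps -> (0 < N)%N ->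
  16%:R / eps ^+ 2 <= N%:R -> 4 * expR (- (ln N%:R / 2)) <= eps.
Proof.
move=> e0 N0 HN.
rewrite -(@ler_pXn2r _ 2) ?nnegrE ?mulr_ge0 ?expR_ge0 ?(ltW e0) //.
rewrite exprMn expr2 [expR _ ^+ 2]expr2 -expRD.
rewrite (_ : - (ln N%:R / 2) + - (ln N%:R / 2) = - ln N%:R); last by field.
rewrite expRN -natr_expR_ln // ler_pdivrMr ?ltr0n //.
by move: HN; rewrite ler_pdivrMr ?exprn_gt0 // [N%:R * _]mulrC; lra.
Qed.

End Numerics.

(** * Counting small sets, and the union bound *)

Section UnionBound.
Context {R : realType}.

(** Such a set is the image of a function from ['I_K]: enumerate it and pad with one of its
    elements, which exists by nonemptiness. *)
Lemma card_small_sets (N K : nat) :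
  (#|[set I : {set 'I_N} | (0 < #|I| <= K)%N]%SET| <= N ^ K)%N.
Proof.
pose f (g : {ffun 'I_K -> 'I_N}) := [set g k | k : 'I_K]%SET.
have sub : [set I : {set 'I_N} | (0 < #|I| <= K)%N]%SET \subset f @: [set: {ffun _}]%SET.
  apply/fintype.subsetP => I; rewrite inE => /andP[/card_gt0P[i0 i0I] IK].
  apply/imsetP; exists [ffun k : 'I_K => nth i0 (enum I) k]; first by rewrite inE.
  apply/setP => i; apply/idP/imsetP => [iI|[k _ ->]]; last first.
    rewrite ffunE; have [kI|kI] := ltnP k (size (enum I)).
      by rewrite -mem_enum mem_nth.
    by rewrite nth_default.
  have iK : (index i (enum I) < K)%N.
    by apply: leq_trans IK; rewrite cardE index_mem mem_enum.
  by exists (Ordinal iK) => //; rewrite ffunE /= nth_index // mem_enum.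
apply: leq_trans (subset_leq_card sub) _; apply: leq_trans (leq_imset_card _ _) _.
by rewrite cardsT card_ffun !card_ord.
Qed.

Context {d : measure_display} {T : measurableType d} (P : probability T R).

Lemma union_bound (J : finType) (S : {set J}) (B : J -> set T) (b : R) :
  (forall j, j \in S -> measurable (B j)) ->
  (forall j, j \in S -> (P (B j) <= b%:E)%E) ->
  measurable (\big[setU/set0]_(j in S) B j) /\
  (P (\big[setU/set0]_(j in S) B j) <= (#|S|%:R * b)%:E)%E.
Proof.
move=> mB bB; rewrite -big_enum cardE.
have : {subset enum S <= S} by move=> j; rewrite mem_enum.
elim: (enum S) => [_|j s IH sS].
  by rewrite big_nil mul0r measure0; split.
have [i si|m1 b1] := IH; first by apply: sS; rewrite inE si orbT.
have jS : j \in S by apply: sS; rewrite inE eqxx.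
rewrite big_cons; split; first exact: measurableU (mB _ jS) m1.
apply: le_trans (measureU2 _ (mB _ jS) m1) _.
by rewrite /= -natr1 mulrDl mul1r addrC EFinD leeD // bB.
Qed.

End UnionBound.

(** * The exceptional events and their probabilities *)

Section GoodEvent.
Context {R : realType} {d : measure_display} {T : measurableType d}.
Context (P : probability T R) {M N : nat} (Phi : 'I_M -> 'I_N -> {RV P >-> R}).

Lemma dotcv_realization (I J : {set 'I_N}) (w : T) :
  dotcv (\sum_(i in I) col i (realization Phi w))
    (\sum_(j in J) col j (realization Phi w)) = flat_dot Phi I J w.
Proof.
rewrite /dotcv /flat_dot; apply: eq_bigr => m _; rewrite !summxE.
by congr (_ * _); apply: eq_bigr => i _; rewrite !mxE.
Qed.

Lemma gram_realization (j : 'I_N) (w : T) :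
  gram (realization Phi w) j j = \sum_m Phi m j w ^+ 2.
Proof. by apply: eq_bigr => m _; rewrite !mxE expr2. Qed.

(** Pairs with an empty set satisfy the inequality trivially, and [flat_dot_tail] divides by the
    square root of the product of the sizes. *)
Definition bad_pairs (K : nat) : {set {set 'I_N} * {set 'I_N}} :=
  [set p : {set 'I_N} * {set 'I_N} | [disjoint p.1 & p.2]%B && (0 < #|p.1| <= K)%N &&
           (0 < #|p.2| <= K)%N]%SET.

Lemma card_bad_pairs (K : nat) : (#|bad_pairs K| <= N ^ (2 * K))%N.
Proof.
pose S := [set I : {set 'I_N} | (0 < #|I| <= K)%N]%SET.
have sub : bad_pairs K \subset finset.setX S S.
  by apply/fintype.subsetP => p; rewrite !inE => /andP[/andP[_ ->] ->].
apply: leq_trans (subset_leq_card sub) _.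
rewrite cardsX mul2n -addnn expnD; apply: leq_mul; exact: card_small_sets.
Qed.

Definition bad_flat (K : nat) (theta : R) : set T :=
  \big[setU/set0]_(p in bad_pairs K)
    [set w | theta * Num.sqrt (#|p.1|%:R * #|p.2|%:R) < `|flat_dot Phi p.1 p.2 w|].

Definition bad_col (t : R) : set T :=
  \big[setU/set0]_(j in [set: 'I_N]%SET)
    [set w | t < `|\sum_m Phi m j w ^+ 2 - 1|].

(** An exact equivalence, so that the good event inherits measurability from finite unions. *)
Lemma flat_RO_badP (K : nat) (theta : R) (w : T) : 0 <= theta ->
  has_flat_RO (realization Phi w) K theta <-> ~ bad_flat K theta w.
Proof.
move=> t0; rewrite /bad_flat -big_enum -bigcup_seq; split.
  move=> flat [[I J]] /=; rewrite mem_enum inE /=.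
  move=> /andP[/andP[dIJ /andP[_ IK]] /andP[_ JK]].
  by rewrite ltNge -dotcv_realization flat.
move=> nbad I J dIJ IK JK; rewrite dotcv_realization.
have [I0|I0] := posnP #|I|.
  rewrite /flat_dot (cards0_eq I0) big1 => [|m _]; last by rewrite big_set0 mul0r.
  by rewrite normr0 mulr_ge0 ?sqrtr_ge0.
have [J0|J0] := posnP #|J|.
  rewrite /flat_dot (cards0_eq J0) big1 => [|m _]; last by rewrite big_set0 mulr0.
  by rewrite normr0 mulr_ge0 ?sqrtr_ge0.
rewrite leNgt; apply/negP => lt; apply: nbad; exists (I, J) => //=.
by rewrite mem_enum inE /= dIJ I0 J0 IK JK.
Qed.

Lemma ric1_badP (t : R) (w : T) : (0 < N)%N ->
  ric (realization Phi w) 1 <= t <-> ~ bad_col t w.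
Proof.
move=> N0; rewrite ric1_leP // /bad_col -big_enum -bigcup_seq; split.
  by move=> H [j _] /=; rewrite ltNge -gram_realization H.
move=> nbad j; rewrite leNgt; apply/negP => lt; apply: nbad; exists j.
  by rewrite /= mem_enum inE.
by rewrite /= -gram_realization.
Qed.

Hypothesis M0 : (0 < M)%N.
Hypothesis iidPhi : iid_normal Phi 0 M%:R^-1.

Lemma bad_flat_bound (K : nat) (theta : R) : 0 < theta -> theta <= 2^-1 ->
  measurable (bad_flat K theta) /\
  (P (bad_flat K theta) <=
    ((N ^ (2 * K))%:R * (2 * expR (- (M%:R * theta ^+ 2 / 3))))%:E)%E.
Proof.
move=> t0 t1.
have [|p pb|mB B] := @union_bound _ _ _ P _ (bad_pairs K)
  (fun p => [set w | theta * Num.sqrt (#|p.1|%:R * #|p.2|%:R) <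
    `|flat_dot Phi p.1 p.2 w|]) (2 * expR (- (M%:R * theta ^+ 2 / 3))).
- by move=> p _; apply: measurable_norm_gt; exact: measurable_flat_dot.
- move: pb; rewrite inE => /andP[/andP[dIJ /andP[I0 _]] /andP[J0 _]].
  exact: flat_dot_tail.
split=> //; apply: le_trans B _; rewrite lee_fin; apply: ler_wpM2r.
  by rewrite mulr_ge0 ?expR_ge0.
by rewrite ler_nat card_bad_pairs.
Qed.

Lemma bad_col_bound (t : R) : 0 < t -> t <= 2^-1 ->
  measurable (bad_col t) /\
  (P (bad_col t) <= (N%:R * (2 * expR (- (M%:R * t ^+ 2 / 8))))%:E)%E.
Proof.
move=> t0 t1; rewrite -[in N%:R](card_ord N) -cardsT.
apply: union_bound => j _.
  by apply: measurable_norm_gt; apply: measurable_funB => //; exact: measurable_col_sqr.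
exact: col_sqr_tail.
Qed.

End GoodEvent.

Lemma has_RIP_le (R : realType) (M N : nat) (Phi : 'M[R]_(M, N)) K (a b : R) :
  a <= b -> has_RIP Phi K a -> has_RIP Phi K b.
Proof.
move=> ab /has_RIPP H; apply/has_RIPP => x xK.
by apply: le_trans (H x xK) _; rewrite ler_wpM2r ?sqr_ge0.
Qed.

Theorem theorem14 (R : realType) :
  let C : R := 75%:R in
  let alpha : R := 100%:R^-1 in
  forall eps : R, 0 < eps ->
  exists N0 : nat, forall (N M K : nat) (delta : R),
    (N0 <= N)%N -> (2 <= K)%N -> (K <= N)%N -> 0 < delta -> delta < 1 ->
    33%:R * C ^+ 2 / delta ^+ 2 * K%:R * ln (K%:R : R) ^+ 2 * ln (N%:R : R)
      <= M%:R ->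
  forall (d : measure_display) (T : measurableType d) (P : probability T R)
    (Phi : 'I_M -> 'I_N -> {RV P >-> R}),
    iid_normal Phi 0 M%:R^-1 ->
    ((1 - eps)%:E <=
      P [set w : T |
          (has_flat_RO (realization Phi w) K
            ((1 - alpha) * delta / (2%:R * C * ln K%:R)) /\
          ric (realization Phi w) 1 <= alpha * delta /\
          has_RIP (realization Phi w) (2 * K) delta)%R])%E.
Proof.
move=> C alpha eps e0; exists (Num.bound (16%:R / eps ^+ 2)).
move=> N M K delta NN K2 KN d0 d1 HM d T P Phi iidPhi.
have N2 : (2 <= N)%N by exact: leq_trans KN.
have N0 : (0 < N)%N by exact: leq_trans N2.
set L := ln (K%:R : R) in HM *; set n := ln (N%:R : R) in HM *.
have L35 : 3 / 5 <= L by exact: ln_nat_ge.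
have L0 : 0 < L by lra.
have n0 : 0 < n by have := ln_nat_ge (R := R) N2; rewrite /n; lra.
have k2 : 2 <= K%:R :> R by rewrite ler_nat.
have k0 : 0 < K%:R :> R by lra.
have M0 : (0 < M)%N.
  rewrite -(ltr0n R); apply: lt_le_trans HM.
  have C0 : 0 < C by rewrite ltr0n.
  rewrite mulr_gt0 // mulr_gt0 ?exprn_gt0 // mulr_gt0 //.
  by rewrite divr_gt0 ?mulr_gt0 ?exprn_gt0 ?ltr0n.
set theta := (1 - alpha) * delta / _; set t := alpha * delta.
have t0 : 0 < t by rewrite mulr_gt0 // invr_gt0 ltr0n.
have t1 : t <= 2^-1 by rewrite /t /alpha; lra.
(* [150 = 2C], so the product is [(1 - alpha) delta]. *)
have thE : theta * (150 * L) = 99%:R / 100%:R * delta.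
  by rewrite /theta /alpha /C; field; rewrite gt_eqF.
have th0 : 0 < theta.
  by rewrite /theta /alpha /C divr_gt0 ?mulr_gt0 ?ltr0n //; lra.
have th1 : theta <= 2^-1.
  (* Otherwise [theta * (150 * L)] would be at least [45], yet it is below [1]. *)
  rewrite leNgt; apply/negP => h.
  have : 2^-1 * (150 * (3 / 5)) <= theta * (150 * L) by rewrite ler_pM //; lra.
  by rewrite thE; lra.
have [mF PF] := bad_flat_bound M0 iidPhi K th0 th1.
have [mC PC] := bad_col_bound M0 iidPhi t0 t1.
set E := [set w | _].
(* The isometry property follows from the other two, so it adds no exceptional event. *)
have -> : E = ~` (bad_flat Phi K theta `|` bad_col Phi t).
  apply/seteqP; split=> w /=.
    by move=> [/(flat_RO_badP _ _ _ (ltW th0)) F [/(ric1_badP _ _ _ N0) c _]] [].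
  move=> nb; have F : has_flat_RO (realization Phi w) K theta.
    by apply/flat_RO_badP; [exact: ltW | move=> b; apply: nb; left].
  have c : ric (realization Phi w) 1 <= t.
    by apply/ric1_badP => // b; apply: nb; right.
  split=> //; split=> //.
  apply: has_RIP_le (flat_RO_RIP (ltW th0) F (proj1 (ric1_leP _ _ N0) c)).
  (* The column norms use up [alpha delta], the off-diagonal part at most [(1 - alpha) delta]. *)
  have -> : delta = t + theta * (150 * L) by rewrite thE /t /alpha; field.
  by rewrite lerD2l mulrC ler_wpM2l ?(ltW th0) // rip_log_bound.
rewrite probability_setC; last exact: measurableU.
rewrite EFinB leeB //; apply: le_trans (measureU2 _ mF mC) _.
apply: le_trans (leeD PF PC) _; rewrite -EFinD lee_fin.
have NE : N%:R = expR n by exact: natr_expR_ln.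
(* Each bad event has probability at most [2 / sqrt N]; the choice of [N0] gives [N >= 16 / eps^2],
   hence [4 / sqrt N <= eps]. *)
apply: (@le_trans _ _ (2 * expR (- (n / 2)) + 2 * expR (- (n / 2)))).
  apply: lerD; rewrite mulrCA ler_wpM2l //.
    rewrite natrX NE -expRM_natl -expRD ler_expR natrM.
    have := flat_exponent d0 L0 (ltW k0) (ltW n0) HM.
    rewrite -/C -/alpha -/theta => h.
    have : 2 * n <= K%:R * n by rewrite ler_wpM2r ?(ltW n0).
    lra.
  rewrite NE -expRD ler_expR.
  have := col_exponent d0 L35 k2 (ltW n0) HM; rewrite -/alpha -/t; lra.
have -> : 2 * expR (- (n / 2)) + 2 * expR (- (n / 2)) = 4 * expR (- (n / 2)).
  by ring.
apply: four_expR_half_ln => //.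
apply: le_trans (ltW (archi_boundP _)) _; first by rewrite divr_ge0 ?exprn_ge0 ?ltW.
by rewrite ler_nat.
Qed.
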